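(* There is a polynomial-time algorithm that, given two Horn formulae $F_1$ and $F_2$, decides whether the lexicographic orders $[F_1,F_2]$ and $[F_1]$ are equivalent.
   Context: A Horn formula is a CNF formula (a set of clauses) in which every clause contains at most one positive literal. Models are truth assignments. For a formula $F$: $I \leq_F J$ iff $I \models F$ or $J \not\models F$. For a sequence $S=[S_1,\ldots,S_m]$: $I \leq_S J$ iff either $S=[]$, or ($I \leq_{S_1} J$ and (either $J \not\leq_{S_1} I$ or $I \leq_R J$)), where $R=[S_2,\ldots,S_m]$. Two sequences $S$ and $R$ are equivalent if $I \leq_S J$ and $I\leq_R J$ coincide for all pairs of models $I,J$. *)

(* Defs.v *)
From Stdlib Require Import PArith.
From mathcomp Require Import all_boot.
Set Implicit Arguments. Unset Strict Implicit. Unset Printing Implicit Defensive.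

(* A literal is (sign, variable): (true, v) is v, (false, v) is not v.   *)
Definition literal := (bool * nat)%type.
Definition clause := seq literal.
Definition formula := seq clause.

Definition horn (F : formula) : bool :=
  all (fun C : clause => count (fun l : literal => l.1) C <= 1) F.

Definition assignment := nat -> bool.

Definition sat_lit (I : assignment) (l : literal) : bool :=
  if l.1 then I l.2 else ~~ I l.2.
Definition sat_clause (I : assignment) (C : clause) : bool := has (sat_lit I) C.
Definition sat (I : assignment) (F : formula) : bool := all (sat_clause I) F.

Definition le_F (F : formula) (I J : assignment) : bool := sat I F || ~~ sat J F.

Fixpoint le_S (S : seq formula) (I J : assignment) : bool :=
  match S with
  | [::] => true
  | S1 :: R => le_F S1 I J && (~~ le_F S1 J I || le_S R I J)
  end.

Definition seq_equiv (S R : seq formula) : Prop :=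
  forall I J : assignment, le_S S I J = le_S R I J.

Inductive move := MoveL | MoveR | Stay.

(* States are 'I_(nQ.+1); the tape alphabet is 'I_(nS.+6), where symbol 0
   is the blank and symbols 1..5 are the input symbols. *)
Record TM := mkTM {
  tm_nQ : nat;
  tm_nS : nat;
  tm_start : 'I_(tm_nQ.+1);
  tm_acc : 'I_(tm_nQ.+1);
  tm_rej : 'I_(tm_nQ.+1);
  tm_delta : 'I_(tm_nQ.+1) -> 'I_(tm_nS.+3.+3) -> 'I_(tm_nQ.+1) * 'I_(tm_nS.+3.+3) * move
}.

Section TMsem.
Variable M : TM.
Definition tsym := 'I_((tm_nS M).+3.+3).
Definition tstate := 'I_((tm_nQ M).+1).
Definition blank : tsym := ord0.

(* configuration: state, tape left of head (nearest first), scanned symbol,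
   tape right of head (nearest first); unwritten cells are blank *)
Record config := Config {
  c_state : tstate; c_left : seq tsym; c_cur : tsym; c_right : seq tsym }.

Definition halted (q : tstate) : bool := (q == tm_acc M) || (q == tm_rej M).

Definition step (c : config) : config :=
  let q := c_state c in
  if halted q then c else
  let: (q', a, m) := @tm_delta M q (c_cur c) in
  match m with
  | Stay => Config q' (c_left c) a (c_right c)
  | MoveR => Config q' (a :: c_left c) (head blank (c_right c)) (behead (c_right c))
  | MoveL => match c_left c with
             | [::] => Config q' [::] a (c_right c)
             | b :: l => Config q' l b (a :: c_right c)
             end
  end.

Definition run (n : nat) (c : config) : config := iter n step c.

Definition in_sym (s : 'I_5) : tsym := inord (s.+1).

Definition init (w : seq 'I_5) : config :=
  let t := map in_sym w in Config (tm_start M) [::] (head blank t) (behead t).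
End TMsem.

(* ---------- Encoding of a pair of formulae over the alphabet 'I_5 ----------
   symbols: 0,1 = bits; 2 = end of literal; 3 = end of clause;
   4 = end of formula.  A variable v is written in binary
   (the bits of v+1 below its leading one, least significant first). *)
Fixpoint pos_bits (p : positive) : seq bool :=
  match p with
  | xH => [::]
  | xO q => false :: pos_bits q
  | xI q => true :: pos_bits q
  end.

Definition sym_of_nat (k : nat) : 'I_5 := inord k.
Definition enc_bit (b : bool) : 'I_5 := sym_of_nat (nat_of_bool b).
Definition enc_var (v : nat) : seq 'I_5 := map enc_bit (pos_bits (Pos.of_succ_nat v)).
Definition enc_lit (l : literal) : seq 'I_5 :=
  enc_bit l.1 :: enc_var l.2 ++ [:: sym_of_nat 2].
Definition enc_clause (C : clause) : seq 'I_5 :=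
  flatten (map enc_lit C) ++ [:: sym_of_nat 3].
Definition enc_formula (F : formula) : seq 'I_5 :=
  flatten (map enc_clause F) ++ [:: sym_of_nat 4].
Definition enc_pair (F1 F2 : formula) : seq 'I_5 := enc_formula F1 ++ enc_formula F2.

Definition poly_time_decides_horn_pairs (M : TM) (P : formula -> formula -> Prop) : Prop :=
  tm_acc M != tm_rej M /\
  exists c k : nat,
    forall F1 F2 : formula, horn F1 -> horn F2 ->
      let w := enc_pair F1 F2 in
      exists t : nat, t <= c * (size w) ^ k + c /\
        ((c_state (@run M t (init M w)) = tm_acc M /\ P F1 F2) \/
         (c_state (@run M t (init M w)) = tm_rej M /\ ~ P F1 F2)).

(* Main.v *)
Require Import Defs.
From mathcomp Require Import all_boot zify.
Set Implicit Arguments. Unset Strict Implicit. Unset Printing Implicit Defensive.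

(* The orders [F1, F2] and [F1] coincide iff F2 is constant both on the models and on the
   countermodels of F1, that is, iff neither b = true nor b = false admits both an assignment
   with (F1, F2) = (b, true) and one with (F1, F2) = (b, false).  To decide whether an assignment
   gives F1 and F2 the truth values b1 and b2, let G consist of the formulas to be satisfied and
   choose one clause of each formula to be falsified.  Start from the assignment making true just
   the variables occurring negatively in the chosen clauses, and repeatedly make the positive
   literal of each falsified clause of G true.  As G is Horn, the result is included in every
   model of G falsifying the chosen clauses, and it is itself such a model if one exists.

   The Turing machine keeps on every tape cell the input symbol and, for finitely many registers
   (pointers to positions, sets of positions, flags), one bit each.  An elementary operation is a
   left-to-right sweep by a two-state Mealy machine followed by a rewind.  Programs only loop over
   the positions of the input, so their running time is polynomial by construction. *)

(** * Sweeping machines on one tape *)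

Local Arguments run : simpl never.

Lemma runS M n (c : config M) : run n.+1 c = run n (step c).
Proof. exact: iterSr. Qed.

Lemma runD M m n (c : config M) : run (m + n) c = run n (run m c).
Proof. by rewrite addnC /run iterD. Qed.

Section Sweep.
Variable cell : finType.

Definition mealy := bool -> cell -> bool * cell.

Fixpoint sweep (f : mealy) (b : bool) (W : seq cell) : bool * seq cell :=
  if W is c :: W1 then
    let x := f b c in let y := sweep f x.1 W1 in (y.1, x.2 :: y.2)
  else (b, [::]).

Lemma size_sweep f b W : size (sweep f b W).2 = size W.
Proof. by elim: W b => //= c W IH b; rewrite IH. Qed.

(* A sweep followed by a jump: to the first target if the final state is true, else to the second. *)
Definition instr := (mealy * nat * nat)%type.

Definition sstep (prog : seq instr) (x : nat * seq cell) : nat * seq cell :=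
  let: (f, jt, jf) := nth (fun b c => (b, c), 0, 0) prog x.1 in
  let y := sweep f false x.2 in (if y.1 then jt else jf, y.2).

Variables (isfst isend : pred cell) (ini : bool -> option 'I_5 -> cell).
Variable prog : seq instr.

(** Two addresses lie beyond the last instruction: [size prog] accepts and [(size prog).+1]
    rejects. *)
Definition pcs := 'I_(size prog).+2.

(* [inl (pc, b, false)]: sweeping with Mealy state [b]; [inl (pc, _, true)]: rewinding;
   [inr b]: turning the input into cells, with [b] true on the first one. *)
Definition mstate : finType := (pcs * bool * bool + bool)%type.

Definition go (pc : nat) : mstate := inl (inord pc, false, false).
Definition back (pc : nat) : mstate := inl (inord pc, false, true).

(** The [Stay] moves at both ends keep the head on the cells already written: a sweep stops on the
    [isend] cell, a rewind on the [isfst] cell. The conversion of the input turns the first blank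
    into the end cell. *)
Definition mdelta (q : mstate) (a : option 'I_5 + cell) :
  mstate * (option 'I_5 + cell) * move :=
  match q, a with
  | inl (pc, b, false), inr c =>
      let: (f, jt, jf) := nth (fun b c => (b, c), 0, 0) prog pc in
      let y := f b c in
      if isend c then (back (if y.1 then jt else jf), inr y.2, Stay)
      else (inl (pc, y.1, false), inr y.2, MoveR)
  | inl (pc, b, true), inr c =>
      if isfst c then (go pc, inr c, Stay) else (q, inr c, MoveL)
  | inr b, inl (Some i) => (inr false, inr (ini b (Some i)), MoveR)
  | inr b, inl None => (back 0, inr (ini b None), Stay)
  | _, _ => (q, a, Stay)
  end.

(** * Coding of states and cells by ordinals *)

Definition state_code (q : mstate) : 'I_(#|mstate|.-1.+1) := inord (enum_rank q).
Definition state_decode (i : 'I_(#|mstate|.-1.+1)) : mstate := nth (go 0) (enum mstate) i.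

Lemma state_codeK : cancel state_code state_decode.
Proof.
move=> q; rewrite /state_decode /state_code inordK ?nth_enum_rank //.
by rewrite prednK ?ltn_ord //; apply/card_gt0P; exists q.
Qed.

(** The codes 0 and 1 to 5 are imposed by [blank] and [in_sym]; the cells follow from 6 on. *)
Definition sym_code (a : option 'I_5 + cell) : 'I_(#|cell|.+3.+3) :=
  match a with
  | inl None => ord0
  | inl (Some i) => inord i.+1
  | inr c => inord (enum_rank c + 6)
  end.

Definition sym_decode (i : 'I_(#|cell|.+3.+3)) : option 'I_5 + cell :=
  if i == 0 :> nat then inl None
  else if i < 6 then inl (Some (inord i.-1))
  else inr (nth (ini false None) (enum cell) (i - 6)).

Lemma sym_codeK : cancel sym_code sym_decode.
Proof.
case=> [[i|]|c] /=; rewrite /sym_decode //.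
- have lt6 := ltn_ord i; rewrite inordK; last lia.
  rewrite /=; case: ifP => [_|]; last lia.
  by congr (inl (Some _)); apply: val_inj; rewrite /= inordK.
rewrite inordK; last by rewrite addnC; exact: (ltn_ord (enum_rank c)).
rewrite addn_eq0 andbF ltnNge leq_addl /= addnK nth_enum_rank //.
Qed.

Definition sweepTM : TM :=
  @mkTM #|mstate|.-1 #|cell| (state_code (inr true))
    (state_code (go (size prog))) (state_code (go (size prog).+1))
    (fun q a => let: (q', a', m) := mdelta (state_decode q) (sym_decode a) in
                (state_code q', sym_code a', m)).

Definition cc (c : cell) : tsym sweepTM := sym_code (inr c).

Definition conf (q : mstate) (l : seq cell) (c : cell) (r : seq cell) : config sweepTM :=
  @Config sweepTM (state_code q) (map cc l) (cc c) (map cc r).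

Lemma step_conf q l c r (q' : mstate) (c' : cell) (m : move) :
  q != go (size prog) -> q != go (size prog).+1 ->
  mdelta q (inr c) = (q', inr c', m) ->
  step (conf q l c r) =
  match m with
  | Stay => conf q' l c' r
  | MoveR => @Config sweepTM (state_code q') (map cc (c' :: l))
               (head (blank sweepTM) (map cc r)) (behead (map cc r))
  | MoveL => if l is d :: l1 then conf q' l1 d (c' :: r) else conf q' l c' r
  end.
Proof.
move=> qa qr md; rewrite /step /= /halted.
rewrite !(can_eq state_codeK) (negbTE qa) (negbTE qr) /=.
rewrite [sym_decode _]sym_codeK state_codeK md.
by case: m {md} => //; case: l.
Qed.

Lemma inord_pc pc : pc <= (size prog).+1 -> (inord pc : pcs) = pc :> nat.
Proof. by move=> h; rewrite inordK. Qed.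

Lemma running_neq pc b d acc : pc < size prog -> size prog <= acc <= (size prog).+1 ->
  (inl (inord pc, b, d) : mstate) != go acc.
Proof.
move=> h /andP[h1 h2]; apply/eqP => -[/(congr1 val) /= e _ _].
by move: e; rewrite !inordK; lia.
Qed.

Lemma back_neq (pc : pcs) b acc : (inl (pc, b, true) : mstate) != go acc.
Proof. by apply/eqP => -[]. Qed.

(** Induction on the unread cells [U]. The rewritten cells pile up in reverse order on the left,
    hence the arbitrary [l]; on the last cell the head stays, ready for the rewind. *)
Lemma run_sweep pc f jt jf : pc < size prog ->
  nth (fun b c => (b, c), 0, 0) prog pc = (f, jt, jf) ->
  forall U c b l b' c' U',
  all (predC isend) (belast c U) -> isend (last c U) ->
  sweep f b (c :: U) = (b', c' :: U') ->
  run (size U).+1 (conf (inl (inord pc, b, false)) l c U) =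
  conf (back (if b' then jt else jf)) (rev (belast c' U') ++ l) (last c' U') [::].
Proof.
move=> ltpc epc U; elim: U => [|d U IH] c b l b' c' U' /=.
  move=> _ ec [<- <- <-].
  rewrite runS /run /= (@step_conf _ _ _ _ (back (if (f b c).1 then jt else jf)) (f b c).2 Stay) //.
  - by apply: running_neq => //; lia.
  - by apply: running_neq => //; lia.
  by rewrite /= inord_pc ?epc ?ec //; lia.
case/andP=> nec nU eU.
case E: (f b c) => [b1 c1]; case E2: (f b1 d) => [b2 c2] /= [<- <- <-].
rewrite runS (@step_conf _ _ _ _ (inl (inord pc, b1, false)) c1 MoveR); first last.
- by rewrite /= inord_pc ?epc ?(negbTE nec) ?E //; lia.
- by apply: running_neq => //; lia.
- by apply: running_neq => //; lia.
rewrite -[Config _ _ _ _]/(conf _ (c1 :: l) d U).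
rewrite (IH d b1 (c1 :: l) (sweep f b2 U).1 c2 (sweep f b2 U).2 nU eU) /= ?E2 //.
by rewrite rev_cons cat_rcons.
Qed.

Lemma run_rewind pc l c r c0 U0 : pc <= (size prog).+1 ->
  all (predC isfst) (belast c l) -> isfst (last c l) -> rev (c :: l) ++ r = c0 :: U0 ->
  run (size l).+1 (conf (back pc) l c r) = conf (go pc) [::] c0 U0.
Proof.
move=> hpc; elim: l c r => [|d l IH] c r /=.
  move=> _ fc [<- <-]; rewrite runS /run /= (@step_conf _ _ _ _ (go pc) c Stay) ?back_neq //.
  by rewrite /= fc inord_pc.
case/andP=> nfc nl fl e; rewrite runS.
rewrite (@step_conf _ _ _ _ (back pc) c MoveL) ?back_neq //; last by rewrite /= (negbTE nfc).
by apply: IH => //; rewrite -e (rev_cons c) cat_rcons.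
Qed.

Fixpoint init_tape (b : bool) (w : seq 'I_5) : seq cell :=
  if w is i :: w1 then ini b (Some i) :: init_tape false w1 else [:: ini b None].

Lemma run_init_tape w b l c l' : rev (init_tape b w) ++ l = c :: l' ->
  let t := map (@in_sym sweepTM) w in
  run (size w).+1 (@Config sweepTM (state_code (inr b)) (map cc l)
    (head (blank sweepTM) t) (behead t)) = conf (back 0) l' c [::].
Proof.
have nq d acc : (inr d : mstate) != go acc by [].
elim: w b l => [|i w IH] b l /=.
  move=> [<- <-]; rewrite runS /step /= /halted !(can_eq state_codeK) /=.
  by rewrite -[blank _]/(sym_code (inl None)) sym_codeK state_codeK.
rewrite rev_cons cat_rcons => /IH {}IH; rewrite -IH /= runS; congr (run _ _).
rewrite /step /= /halted !(can_eq state_codeK) /=.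
by rewrite -[in_sym _ i]/(sym_code (inl (Some i))) sym_codeK state_codeK.
Qed.

(** The two marks occur at the two ends and nowhere else, so that sweeps and rewinds stop exactly
    there. *)
Definition tape_ok (W : seq cell) : bool :=
  (map isfst W == true :: nseq (size W).-1 false) &&
  (map isend W == rcons (nseq (size W).-1 false) true).

Lemma tape_okP W : tape_ok W -> exists c U,
  [/\ W = c :: U, isfst c, all (predC isfst) U, all (predC isend) (belast c U)
    & isend (last c U)].
Proof.
case: W => [|c U] // /andP[/eqP /= [fc fU] /eqP eU]; exists c, U; split=> //.
- by have := all_nseq negb (size U) false; rewrite orbT -fU all_map.
- move: eU; rewrite -map_cons lastI map_rcons => /rcons_inj [eU _].
  by have := all_nseq negb (size U) false; rewrite orbT -eU all_map.
by move: eU; rewrite -map_cons lastI map_rcons => /rcons_inj [_ ->].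
Qed.

Definition mconf (x : nat * seq cell) : config sweepTM :=
  conf (go x.1) [::] (head (ini false None) x.2) (behead x.2).

Lemma run_back pc W c l : pc <= (size prog).+1 -> tape_ok W -> rev W = c :: l ->
  run (size W) (conf (back pc) l c [::]) = mconf (pc, W).
Proof.
move=> hpc /tape_okP[c0 [U [eW fc nU _ _]]] rW.
have : c :: l = rcons (rev U) c0 by rewrite -rW eW rev_cons.
rewrite lastI => /rcons_inj [eb el].
have -> : size W = (size l).+1 by rewrite -size_rev rW.
rewrite (run_rewind (c0 := c0) (U0 := U)) // ?eW //.
- by rewrite eb all_rev.
- by rewrite el.
by rewrite cats0 -rW revK.
Qed.

Lemma run_init w : tape_ok (init_tape true w) ->
  run (size w + size w).+2 (init sweepTM w) = mconf (0, init_tape true w).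
Proof.
move=> ok; case E: (rev (init_tape true w)) => [|c l].
  by move/(congr1 size): E; rewrite size_rev; case: (w).
(* The first [(size w).+1] steps write the tape, and as many rewind it. *)
rewrite -addSn -addnS runD (@run_init_tape w true [::] c l) ?cats0 //.
rewrite -(run_back _ ok E) //; congr run.
by elim: w true {ok E} => //= i w IH b; rewrite -IH.
Qed.

Definition keeps_ends (f : mealy) : bool :=
  [forall b, forall c, (isfst (f b c).2 == isfst c) && (isend (f b c).2 == isend c)].

Definition instr_ok (x : instr) : bool :=
  keeps_ends x.1.1 && (maxn x.1.2 x.2 <= (size prog).+1).

Lemma tape_ok_sweep (f : mealy) b W :
  (forall b c, (isfst (f b c).2 == isfst c) && (isend (f b c).2 == isend c)) ->
  tape_ok (sweep f b W).2 = tape_ok W.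
Proof.
move=> ok; rewrite /tape_ok size_sweep.
have -> : map isfst (sweep f b W).2 = map isfst W.
  by elim: W b => //= c W IH b; rewrite IH; have /andP[/eqP -> _] := ok b c.
have -> // : map isend (sweep f b W).2 = map isend W.
by elim: W b => //= c W IH b; rewrite IH; have /andP[_ /eqP ->] := ok b c.
Qed.

Lemma sweepTM_acc_rej : tm_acc sweepTM != tm_rej sweepTM.
Proof.
rewrite /= (can_eq state_codeK); apply/eqP => -[/(congr1 val) /=].
by rewrite !inordK; lia.
Qed.

Hypothesis prog_ok : all instr_ok prog.

Lemma run_sstep x : x.1 < size prog -> tape_ok x.2 ->
  tape_ok (sstep prog x).2 /\
  run (size x.2 + size x.2) (mconf x) = mconf (sstep prog x).
Proof.
case: x => pc W /= lt ok; rewrite /sstep /=.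
case E: (nth _ prog pc) => [[f jt] jf].
have /= := all_nthP (fun b c => (b, c), 0, 0) prog_ok pc lt.
rewrite E => /andP[/forallP pf].
rewrite geq_max /= => /andP[hjt hjf].
have {}pf b c : (isfst (f b c).2 == isfst c) && (isend (f b c).2 == isend c).
  by move/forallP: (pf b).
have ok' : tape_ok (sweep f false W).2 by rewrite tape_ok_sweep.
split=> //; have sz := size_sweep f false W.
have [c [U [eW fc nU nE eE]]] := tape_okP ok.
case E2: (sweep f false W) ok' sz => [b' [|c' U'] //=] ok' sz.
subst W; rewrite runD [size _]/= /mconf /=.
rewrite (run_sweep lt E [::] nE eE E2) cats0 -[(size U).+1]sz.
rewrite -[(size U').+1]/(size (c' :: U')) (@run_back _ (c' :: U')) //.
  by case: (b').
by rewrite lastI rev_rcons.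
Qed.

Lemma run_sweeps t x y : iter t (sstep prog) x = y ->
  (forall i, i < t -> (iter i (sstep prog) x).1 < size prog) -> tape_ok x.2 ->
  run (t * (size x.2 + size x.2)) (mconf x) = mconf y.
Proof.
move=> <-; elim: t x => [|t IH] x lt ok //.
have [ok1 r1] := run_sstep (lt 0 isT) ok.
rewrite mulSn runD r1 iterSr -IH //; last by move=> i hi; rewrite -iterSr; apply: lt.
by rewrite /sstep; case: (nth _ _ _) => -[f jt] jf /=; rewrite size_sweep.
Qed.

Lemma c_state_mconf x : c_state (mconf x) = state_code (go x.1).
Proof. by []. Qed.

End Sweep.

(** * Loop programs over the positions of the input *)

Definition var := 'I_16.

Record store := Store { ptr : var -> nat; pset : var -> nat -> bool; flag : var -> bool }.

Definition updP s p i := Store (fun x => if x == p then i else ptr s x) (pset s) (flag s).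
Definition updA s a X := Store (ptr s) (fun x => if x == a then X else pset s x) (flag s).
Definition updB s b v := Store (ptr s) (pset s) (fun x => if x == b then v else flag s x).

Inductive op :=
| CopyP of var & var | ZeroP of var | IncP of var
| Put of var & var | Clear of var | SetB of var & bool.

Definition oden (o : op) (s : store) : store :=
  match o with
  | CopyP p q => updP s p (ptr s q)
  | ZeroP p => updP s p 0
  | IncP p => updP s p (ptr s p).+1
  | Put a p => updA s a (fun i => pset s a i || (ptr s p == i))
  | Clear a => updA s a (fun=> false)
  | SetB b v => updB s b v
  end.

(** A pointer may leave the tape; all tests that read through it then fail, hence the bound for
    [InA] in [tden]. *)
Inductive test := SymAt of var & 'I_5 | InA of var & var | TestB of var | AtEnd of var.

Definition tden (w : seq 'I_5) (t : test) (s : store) : bool :=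
  match t with
  | SymAt p a => onth w (ptr s p) == Some a
  | InA a p => (ptr s p <= size w) && pset s a (ptr s p)
  | TestB b => flag s b
  | AtEnd p => ptr s p == size w
  end.

Inductive cmd :=
| Skip | Op of op | Seq of cmd & cmd | If of test & cmd & cmd | For of var & cmd.

Fixpoint den (w : seq 'I_5) (c : cmd) (s : store) : store :=
  match c with
  | Skip => s
  | Op o => oden o s
  | Seq c1 c2 => den w c2 (den w c1 s)
  | If t c1 c2 => if tden w t s then den w c1 s else den w c2 s
  | For p c1 =>
      updP (foldl (fun s i => den w c1 (updP s p i)) s (iota 0 (size w))) p (size w)
  end.

Definition omodP o x := match o with CopyP p _ | ZeroP p | IncP p => x == p | _ => false end.
Definition omodA o x := match o with Put a _ | Clear a => x == a | _ => false end.
Definition omodB o x := match o with SetB b _ => x == b | _ => false end.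

Fixpoint modP (c : cmd) (x : var) : bool :=
  match c with
  | Skip => false | Op o => omodP o x
  | Seq c1 c2 | If _ c1 c2 => modP c1 x || modP c2 x
  | For p c1 => (x == p) || modP c1 x
  end.
Fixpoint modA (c : cmd) (x : var) : bool :=
  match c with
  | Skip => false | Op o => omodA o x
  | Seq c1 c2 | If _ c1 c2 => modA c1 x || modA c2 x
  | For p c1 => modA c1 x
  end.
Fixpoint modB (c : cmd) (x : var) : bool :=
  match c with
  | Skip => false | Op o => omodB o x
  | Seq c1 c2 | If _ c1 c2 => modB c1 x || modB c2 x
  | For p c1 => modB c1 x
  end.

Lemma frameP w c s x : ~~ modP c x -> ptr (den w c s) x = ptr s x.
Proof.
elim: c s => //= [o|c1 IH1 c2 IH2|t c1 IH1 c2 IH2|p c IH] s.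
- by case: o => //= *; rewrite ifN.
- by rewrite negb_or => /andP[h1 h2]; rewrite IH2 // IH1.
- by rewrite negb_or => /andP[h1 h2]; case: ifP => _; rewrite ?IH2 // IH1.
rewrite negb_or => /andP[h1 h2]; rewrite ifN //.
by elim: (iota _ _) s => //= i r IHr s; rewrite IHr IH //= ifN.
Qed.

Lemma frameA w c s x : ~~ modA c x -> pset (den w c s) x = pset s x.
Proof.
elim: c s => //= [o|c1 IH1 c2 IH2|t c1 IH1 c2 IH2|p c IH] s.
- by case: o => //= *; rewrite ifN.
- by rewrite negb_or => /andP[h1 h2]; rewrite IH2 // IH1.
- by rewrite negb_or => /andP[h1 h2]; case: ifP => _; rewrite ?IH2 // IH1.
by move=> h; elim: (iota _ _) s => //= i r IHr s; rewrite IHr IH.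
Qed.

Lemma frameB w c s x : ~~ modB c x -> flag (den w c s) x = flag s x.
Proof.
elim: c s => //= [o|c1 IH1 c2 IH2|t c1 IH1 c2 IH2|p c IH] s.
- by case: o => //= *; rewrite ifN.
- by rewrite negb_or => /andP[h1 h2]; rewrite IH2 // IH1.
- by rewrite negb_or => /andP[h1 h2]; case: ifP => _; rewrite ?IH2 // IH1.
by move=> h; elim: (iota _ _) s => //= i r IHr s; rewrite IHr IH.
Qed.

Lemma for_inv w (J : nat -> store -> Prop) p c s :
  J 0 s -> (forall i s, i < size w -> J i s -> J i.+1 (den w c (updP s p i))) ->
  (forall s, J (size w) s -> J (size w) (updP s p (size w))) ->
  J (size w) (den w (For p c) s).
Proof.
move=> J0 JS Je /=; apply: Je.
have : forall k, k <= size w ->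
  J k (foldl (fun s i => den w c (updP s p i)) s (iota 0 k)).
  elim=> // k IH lt; rewrite -addn1 iotaD foldl_cat addn1 /=.
  by apply: JS => //; apply/IH/ltnW.
by apply.
Qed.

(** * Stores laid out on the tape *)

Definition cell : finType :=
  (option 'I_5 * bool * {ffun var -> bool} * {ffun var -> bool} * {ffun var -> bool})%type.

Definition csym (c : cell) := c.1.1.1.1.
Definition cfst (c : cell) := c.1.1.1.2.
Definition cP (c : cell) := c.1.1.2.
Definition cA (c : cell) := c.1.2.
Definition cB (c : cell) := c.2.
Definition cend (c : cell) := csym c == None.

Definition fupd (f : {ffun var -> bool}) x b := [ffun y => if y == x then b else f y].
Definition upP c p b : cell := (csym c, cfst c, fupd (cP c) p b, cA c, cB c).
Definition upA c a b : cell := (csym c, cfst c, cP c, fupd (cA c) a b, cB c).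
Definition upB c f b : cell := (csym c, cfst c, cP c, cA c, fupd (cB c) f b).

(** A pointer is a mark on one cell, or on none if it is beyond [size w]; a set is given by one
    membership bit per cell; a flag is repeated on all cells. The end cell, at index [size w],
    carries no symbol. *)
Definition enc_cell (w : seq 'I_5) (s : store) (i : nat) : cell :=
  (onth w i, i == 0, [ffun x => ptr s x == i], [ffun x => pset s x i], [ffun x => flag s x]).

Definition enc (w : seq 'I_5) (s : store) : seq cell := mkseq (enc_cell w s) (size w).+1.

(** Only [IncP] uses the Mealy state: it carries the mark of the preceding cell, which shifts the
    mark one cell to the right. *)
Definition opf (o : op) : mealy cell := fun b c =>
  match o with
  | CopyP p q => (b, upP c p (cP c q))
  | ZeroP p => (b, upP c p (cfst c))
  | IncP p => (cP c p, upP c p b)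
  | Put a p => (b, upA c a (cA c a || cP c p))
  | Clear a => (b, upA c a false)
  | SetB f v => (b, upB c f v)
  end.

Definition testf (t : test) : mealy cell := fun b c =>
  (b || match t with
        | SymAt p a => cP c p && (csym c == Some a)
        | InA a p => cP c p && cA c a
        | TestB f => cB c f
        | AtEnd p => cP c p && (csym c == None)
        end, c).

Lemma sweep_map (g : cell -> cell) b W :
  (sweep (fun b c => (b, g c)) b W).2 = map g W.
Proof. by elim: W => //= c W ->. Qed.

Lemma sweep_has (g : pred cell) b W :
  sweep (fun b c => (b || g c, c)) b W = (b || has g W, W).
Proof. by elim: W b => [|c W IH] b /=; rewrite ?orbF // IH orbA. Qed.

Lemma fupd_ffun f x b (g : var -> bool) :
  (forall y, g y = if y == x then b else f y) -> fupd [ffun y => f y] x b = [ffun y => g y].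
Proof. by move=> h; apply/ffunP => y; rewrite !ffunE h. Qed.

Lemma opf_enc w o s : (sweep (opf o) false (enc w s)).2 = enc w (oden o s).
Proof.
case: o => [p q|p|p|a p|a|f v].
- rewrite sweep_map /enc /mkseq -map_comp; apply: eq_map => i.
  congr (_, _, _, _, _); rewrite ffunE; apply: fupd_ffun => y /=.
  by case: (y == p).
- rewrite sweep_map /enc /mkseq -map_comp; apply: eq_map => i.
  congr (_, _, _, _, _); apply: fupd_ffun => y /=; rewrite eq_sym.
  by case: (y == p).
(* Generalised to a sweep entered at cell [a], where the state tells whether the preceding cell bore
   the mark. *)
- have step m a b : b = ((ptr s p).+1 == a) ->
    (sweep (opf (IncP p)) b (map (enc_cell w s) (iota a m))).2 =
    map (enc_cell w (oden (IncP p) s)) (iota a m); last exact: step.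
  elim: m a b => //= m IH a b eb; rewrite ffunE IH ?eqSS // eb.
  congr (_ :: _); congr (_, _, _, _, _); apply: fupd_ffun => y /=.
  by case: (y == p).
- rewrite sweep_map /enc /mkseq -map_comp; apply: eq_map => i.
  congr (_, _, _, _, _); rewrite !ffunE; apply: fupd_ffun => y /=.
  by case: (y == a).
- rewrite sweep_map /enc /mkseq -map_comp; apply: eq_map => i.
  congr (_, _, _, _, _); apply: fupd_ffun => y /=.
  by case: (y == a).
rewrite sweep_map /enc /mkseq -map_comp; apply: eq_map => i.
congr (_, _, _, _, _); apply: fupd_ffun => y /=.
by case: (y == f).
Qed.

Lemma has_ptr w s p (g : pred cell) :
  has (fun c => cP c p && g c) (enc w s) = (ptr s p <= size w) && g (enc_cell w s (ptr s p)).
Proof.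
apply/hasP/andP => [[c /mapP[i]]|[le gp]].
  by rewrite mem_iota => /= lei -> /andP[]; rewrite ffunE => /eqP ->.
exists (enc_cell w s (ptr s p)); last by rewrite ffunE eqxx.
by apply: map_f; rewrite mem_iota.
Qed.

Lemma testf_enc w t s : sweep (testf t) false (enc w s) = (tden w t s, enc w s).
Proof.
rewrite sweep_has; congr (_, _); case: t => [p a|a p|f|p].
- apply: etrans (has_ptr w s p (fun c => csym c == Some a)) _; case: leqP => //= lt.
  by rewrite onth_default // ltnW.
- by apply: etrans (has_ptr w s p (fun c => cA c a)) _; rewrite /= ffunE.
- rewrite /= ffunE; case E: (flag s f) => //=; apply/hasPn => c /mapP[i _ ->].
  by rewrite /cB /= ffunE E.
apply: etrans (has_ptr w s p cend) _; rewrite /= /cend /csym /=.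
case: ltngtP => //= [lt|->]; last by rewrite onth_default ?eqxx.
by have := onthTE w (ptr s p); rewrite lt; case: (onth _ _).
Qed.

(** * Compilation to sweeps and its running time *)

Fixpoint csize (c : cmd) : nat :=
  match c with
  | Skip => 0
  | Op _ => 1
  | Seq c1 c2 => csize c1 + csize c2
  | If _ c1 c2 => (csize c1 + csize c2).+2
  | For _ c1 => (csize c1).+3
  end.

Definition idf : mealy cell := fun b c => (b, c).

(** Jump targets are absolute, with [base] the address of the first instruction. The idle sweep
    [idf] only serves to jump over the second branch. *)
Fixpoint comp (base : nat) (c : cmd) : seq (instr cell) :=
  match c with
  | Skip => [::]
  | Op o => [:: (opf o, base.+1, base.+1)]
  | Seq c1 c2 => comp base c1 ++ comp (base + csize c1) c2
  | If t c1 c2 =>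
      let mid := (base + csize c1).+2 in let fin := mid + csize c2 in
      (testf t, base.+1, mid) :: comp base.+1 c1 ++ (idf, fin, fin) :: comp mid c2
  | For p c1 =>
      (opf (ZeroP p), base.+1, base.+1) ::
      (testf (AtEnd p), (base + csize c1).+3, base.+2) ::
      comp base.+2 c1 ++ [:: (opf (IncP p), base.+1, base.+1)]
  end.

Lemma size_comp base c : size (comp base c) = csize c.
Proof.
elim: c base => //= [c1 IH1 c2 IH2|t c1 IH1 c2 IH2|p c IH] base.
- by rewrite size_cat IH1 IH2.
- by rewrite size_cat /= IH1 IH2 addnS.
by rewrite size_cat IH addn1.
Qed.

(** In [den] a loop sets its pointer afresh at each turn, whereas the compiled loop increments it;
    the two agree when the body leaves the pointer alone. *)
Fixpoint for_ok (c : cmd) : bool :=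
  match c with
  | Seq c1 c2 | If _ c1 c2 => for_ok c1 && for_ok c2
  | For p c1 => ~~ modP c1 p && for_ok c1
  | _ => true
  end.

(** The unit is one sweep. A loop pays a test and an increment per turn, then the initial reset and
    the final test. *)
Fixpoint cost (c : cmd) (n : nat) : nat :=
  match c with
  | Skip => 0
  | Op _ => 1
  | Seq c1 c2 => cost c1 n + cost c2 n
  | If _ c1 c2 => cost c1 n + cost c2 n + 2
  | For _ c1 => n * (cost c1 n + 2) + 2
  end.

(** A loop raises the exponent by one; for sequences and branches it is enough to add the
    exponents. *)
Lemma cost_poly c : exists a k, forall n, cost c n <= a * n.+1 ^ k.
Proof.
have mono (n k k' : nat) : k <= k' -> n.+1 ^ k <= n.+1 ^ k' by apply: leq_pexp2l.
elim: c => [|o|c1 [a1 [k1 h1]] c2 [a2 [k2 h2]]|t c1 [a1 [k1 h1]] c2 [a2 [k2 h2]]|p c [a [k h]]].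
- by exists 0, 0.
- by exists 1, 0.
- exists (a1 + a2), (k1 + k2) => n /=; rewrite mulnDl leq_add //.
    by apply: leq_trans (h1 n) _; rewrite leq_mul2l mono ?orbT // leq_addr.
  by apply: leq_trans (h2 n) _; rewrite leq_mul2l mono ?orbT // leq_addl.
- exists (a1 + a2 + 2), (k1 + k2) => n /=; rewrite !mulnDl !leq_add //.
  + by apply: leq_trans (h1 n) _; rewrite leq_mul2l mono ?orbT // leq_addr.
  + by apply: leq_trans (h2 n) _; rewrite leq_mul2l mono ?orbT // leq_addl.
  by rewrite leq_pmulr // expn_gt0.
exists (a + 4), k.+1 => n /=; rewrite expnS.
have := h n; have : 0 < n.+1 ^ k by rewrite expn_gt0.
by move: (n.+1 ^ k) => m; nia.
Qed.

(** The second conjunct keeps all earlier addresses inside the program, so that the Turing machine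
    has not halted before the end. *)
Definition reach prog x t y :=
  iter t (@sstep cell prog) x = y /\
  forall i, i < t -> (iter i (@sstep cell prog) x).1 < size prog.

Lemma reach_trans prog x t y t' z :
  reach prog x t y -> reach prog y t' z -> reach prog x (t + t') z.
Proof.
case=> [e h] [e' h']; split; first by rewrite addnC iterD e.
move=> i; case: (ltnP i t) => [/h //|le] lt.
by rewrite -(subnK le) iterD e h' // ltn_subLR.
Qed.

Lemma reach_step prog pc W f jt jf b W' : nth (fun b c => (b, c), 0, 0) prog pc = (f, jt, jf) ->
  pc < size prog -> sweep f false W = (b, W') ->
  reach prog (pc, W) 1 (if b then jt else jf, W').
Proof. by move=> e lt es; split=> [|[]] //=; rewrite /sstep e /= es. Qed.

Lemma reach_op prog pc w o s j : nth (fun b c => (b, c), 0, 0) prog pc = (opf o, j, j) ->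
  pc < size prog -> reach prog (pc, enc w s) 1 (j, enc w (oden o s)).
Proof.
move=> e lt; rewrite -opf_enc.
have /(reach_step e lt) := surjective_pairing (sweep (opf o) false (enc w s)).
by case: ifP.
Qed.

Lemma sweep_id b W : sweep idf b W = (b, W).
Proof. by elim: W => //= c W ->. Qed.

Lemma nth_at (T : Type) (x0 : T) (pre post : seq T) x n :
  n = size pre -> nth x0 (pre ++ x :: post) n = x /\ n < size (pre ++ x :: post).
Proof. by move=> ->; rewrite nth_cat ltnn subnn size_cat /= addnS leq_addr. Qed.

(** Induction on the command, for code placed anywhere in a larger program, since subcommands are
    compiled in the middle of the code. *)
Lemma comp_correct c : for_ok c -> forall w s pre post prog,
  prog = pre ++ comp (size pre) c ++ post ->
  exists2 t, t <= cost c (size w) &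
    reach prog (size pre, enc w s) t (size pre + csize c, enc w (den w c s)).
Proof.
elim: c => [|o|c1 IH1 c2 IH2|t c1 IH1 c2 IH2|p c IH] /= ok w s pre post prog ep.
- by exists 0 => //; rewrite addn0.
- have [e lt] :=
    @nth_at _ (fun b c => (b, c), 0, 0) pre post (opf o, (size pre).+1, (size pre).+1) _ erefl.
  by exists 1 => //; rewrite addn1; apply: reach_op; rewrite ep.
- case/andP: ok => ok1 ok2.
  have [|t1 l1 r1] := IH1 ok1 w s pre (comp (size pre + csize c1) c2 ++ post) prog.
    by rewrite ep -?catA.
  have [|t2 l2 r2] := IH2 ok2 w (den w c1 s) (pre ++ comp (size pre) c1) post prog.
    by rewrite ep size_cat size_comp -?catA.
  exists (t1 + t2); first exact: leq_add.
  rewrite size_cat size_comp in r2; rewrite addnA.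
  exact: reach_trans r1 r2.
- case/andP: ok => ok1 ok2.
  set mid := (size pre + csize c1).+2 in ep; set i0 := (testf t, _, _) in ep.
  set i1 := (idf, _, _) in ep.
  have [] :=
    @nth_at _ (fun b c => (b, c), 0, 0) pre ((comp (size pre).+1 c1 ++ i1 :: comp mid c2) ++ post) i0 _ erefl.
  rewrite -[i0 :: _]/((i0 :: _) ++ post) -ep => e0 lt0.
  have r0 := reach_step e0 lt0 (testf_enc w t s).
  have [] :=
    @nth_at _ (fun b c => (b, c), 0, 0) (pre ++ i0 :: comp (size pre).+1 c1) (comp mid c2 ++ post) i1
     (size pre + csize c1).+1.
    by rewrite size_cat /= size_comp addnS.
  have -> : (pre ++ i0 :: comp (size pre).+1 c1) ++ i1 :: comp mid c2 ++ post = prog.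
    by rewrite ep -?catA /= -?catA.
  move=> e1 lt1.
  case: ifP r0 => _ r0.
    have [|t1 l1 r1] := IH1 ok1 w s (rcons pre i0) (i1 :: comp mid c2 ++ post) prog.
      by rewrite ep size_rcons cat_rcons /= -?catA.
    rewrite size_rcons addSn in r1.
    have r2 := @reach_step prog _ (enc w (den w c1 s)) _ _ _ false _ e1 lt1 (sweep_id _ _).
    exists (1 + (t1 + 1)); first by lia.
    have -> : size pre + (csize c1 + csize c2).+2 = mid + csize c2 by rewrite /mid; lia.
    exact: reach_trans r0 (reach_trans r1 r2).
  have [|t2 l2 r2] := IH2 ok2 w s (pre ++ i0 :: rcons (comp (size pre).+1 c1) i1) post prog.
    rewrite ep size_cat /= size_rcons size_comp -?catA /= cat_rcons -?catA /=.
    by rewrite !addnS.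
  rewrite size_cat /= size_rcons size_comp !addnS in r2.
  exists (1 + t2); first by lia.
  have -> : size pre + (csize c1 + csize c2).+2 = mid + csize c2 by rewrite /mid; lia.
  exact: reach_trans r0 r2.
case/andP: ok => np ok.
set i0 := (opf (ZeroP p), _, _) in ep; set i1 := (testf _, _, _) in ep.
set i2 := (opf (IncP p), _, _) in ep.
have [] :=
    @nth_at _ (fun b c => (b, c), 0, 0) pre (i1 :: comp (size pre).+2 c ++ i2 :: post) i0 _ erefl.
have -> : pre ++ i0 :: i1 :: comp (size pre).+2 c ++ i2 :: post = prog by rewrite ep /= -?catA.
move=> e0 lt0; have r0 := reach_op w s e0 lt0.
have [] :=
    @nth_at _ (fun b c => (b, c), 0, 0) (rcons pre i0) (comp (size pre).+2 c ++ i2 :: post) i1 (size pre).+1.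
  by rewrite size_rcons.
have -> : rcons pre i0 ++ i1 :: comp (size pre).+2 c ++ i2 :: post = prog.
  by rewrite ep cat_rcons /= -?catA.
move=> e1 lt1.
have [] :=
    @nth_at _ (fun b c => (b, c), 0, 0) (pre ++ i0 :: i1 :: comp (size pre).+2 c) post i2
  (size pre + csize c).+2.
  by rewrite size_cat /= size_comp !addnS.
have -> : (pre ++ i0 :: i1 :: comp (size pre).+2 c) ++ i2 :: post = prog.
  by rewrite ep -?catA /= -?catA.
move=> e2 lt2.
pose body k := foldl (fun s i => den w c (updP s p i)) s (iota 0 k).
(* Loop invariant: after [k] turns control is back at the test with the pointer at [k]. *)
have loop k : k <= size w -> exists2 t, t <= k * (cost c (size w) + 2) &
    reach prog ((size pre).+1, enc w (updP s p 0)) t ((size pre).+1, enc w (updP (body k) p k)).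
  elim: k => [|k IHk] lt; first by exists 0.
  have [t lt_t rt] := IHk (ltnW lt).
  have rt1 := reach_step e1 lt1 (testf_enc w (AtEnd p) (updP (body k) p k)).
  rewrite /= eqxx (ltn_eqF lt) in rt1.
  have [|t2 lt_t2 rt2] := IH ok w (updP (body k) p k) (pre ++ [:: i0; i1]) (i2 :: post) prog.
    by rewrite ep size_cat addn2 -?catA.
  rewrite size_cat addn2 !addSn in rt2.
  have rt3 := reach_op w (den w c (updP (body k) p k)) e2 lt2.
  exists (t + (1 + (t2 + 1))); first by rewrite mulSn; lia.
  apply: reach_trans rt (reach_trans rt1 (reach_trans rt2 _)).
  (* By [for_ok] the body has left the pointer at [k], so the increment gives [k.+1]. *)
  move: rt3; rewrite /= frameP //= eqxx.
  by rewrite /body -[k.+1]addn1 iotaD foldl_cat addn1.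
have [t lt_t rt] := loop _ (leqnn (size w)).
have rt1 := reach_step e1 lt1 (testf_enc w (AtEnd p) (updP (body (size w)) p (size w))).
rewrite /= !eqxx in rt1.
exists (1 + (t + 1)); first by lia.
have -> : size pre + (csize c).+3 = (size pre + csize c).+3 by rewrite !addnS.
exact: reach_trans r0 (reach_trans rt rt1).
Qed.

Definition init_store : store := Store (fun=> 0) (fun _ _ => false) (fun=> false).

(** All pointers start at 0, so on a fresh tape each pointer mark equals the first-cell mark [b]. *)
Definition ini_cell (b : bool) (a : option 'I_5) : cell :=
  (a, b, [ffun=> b], [ffun=> false], [ffun=> false]).

Lemma init_tape_enc w : init_tape ini_cell true w = enc w init_store.
Proof.
have H (b : bool) v k : b = (k == 0) ->
  init_tape ini_cell b v = [seq (onth v (i - k), i == 0, [ffun=> i == 0], [ffun=> false], [ffun=> false]) : cell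
    | i <- iota k (size v).+1].
  elim: v b k => [|a v IH] b k -> /=; rewrite subnn.
    by rewrite /ini_cell; congr [:: (_, _, _, _, _)]; apply/ffunP => x; rewrite !ffunE.
  congr (_ :: _); rewrite (IH _ k.+1) //; apply/eq_in_map => i.
  by rewrite mem_iota => /andP[lt _]; rewrite -(subnSK lt).
rewrite (H _ _ 0) //; apply: eq_map => i; rewrite subn0.
by congr (_, _, _, _, _); apply/ffunP => x; rewrite !ffunE // eq_sym.
Qed.

Lemma enc_tape_ok w s : tape_ok cfst cend (enc w s).
Proof.
rewrite /tape_ok /enc size_mkseq /mkseq -!map_comp [_.-1]/=; apply/andP; split; apply/eqP.
  rewrite /=; congr (_ :: _); apply/(@eq_from_nth _ false); first by rewrite size_map size_iota size_nseq.
  move=> i; rewrite size_map size_iota => lt.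
  by rewrite (nth_map 0) ?size_iota // nth_iota // nth_nseq lt.
rewrite -[(size w).+1]addn1 iotaD map_cat /= -cats1 /cend /csym /= onth_default //.
congr (_ ++ _); apply/(@eq_from_nth _ false); first by rewrite size_map size_iota size_nseq.
move=> i; rewrite size_map size_iota => lt.
rewrite (nth_map 0) ?size_iota // nth_iota // nth_nseq lt /=.
by have := onthTE w i; rewrite lt; case: onth.
Qed.

Lemma comp_instr_ok c base :
  all (fun x : instr cell => keeps_ends cfst cend x.1.1 && (maxn x.1.2 x.2 <= base + csize c))
    (comp base c).
Proof.
have opok o : keeps_ends cfst cend (opf o).
  by apply/forallP => b; apply/forallP => d; case: o => *; rewrite /= !eqxx.
have testok t : keeps_ends cfst cend (testf t).
  by apply/forallP => b; apply/forallP => d; rewrite /= !eqxx.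
have idok : keeps_ends cfst cend idf.
  by apply/forallP => b; apply/forallP => d; rewrite /= !eqxx.
have wide b b' c' : b <= b' ->
  all (fun x : instr cell => keeps_ends cfst cend x.1.1 && (maxn x.1.2 x.2 <= b)) c' ->
  all (fun x : instr cell => keeps_ends cfst cend x.1.1 && (maxn x.1.2 x.2 <= b')) c'.
  by move=> le; apply: sub_all => x /andP[-> /leq_trans ->].
elim: c base => //= [o|c1 IH1 c2 IH2|t c1 IH1 c2 IH2|p c IH] base.
- by rewrite opok andbT /= maxnn addn1.
- rewrite all_cat (wide _ _ _ _ (IH1 _)) ?(wide _ _ _ _ (IH2 _)) //; lia.
- rewrite all_cat /= testok idok /=.
  rewrite (wide _ _ _ _ (IH1 _)) ?(wide _ _ _ _ (IH2 _)) //; lia.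
rewrite all_cat /= testok !opok /= (wide _ _ _ _ (IH _)) /=; lia.
Qed.

(* The addresses [(csize c).+1] and [(csize c).+2] are the accepting and the rejecting one. *)
Definition decider_code (c : cmd) (b : var) : seq (instr cell) :=
  comp 0 c ++ [:: (testf (TestB b), (csize c).+1, (csize c).+2)].

Definition decider (c : cmd) (b : var) : TM :=
  sweepTM cfst cend ini_cell (decider_code c b).

Lemma decider_correct c b : for_ok c -> exists a k, forall w : seq 'I_5, exists2 t,
  t <= a * (size w).+1 ^ k &
  c_state (run t (init (decider c b) w)) =
  if flag (den w c init_store) b then tm_acc (decider c b) else tm_rej (decider c b).
Proof.
move=> ok; have [a [k hk]] := cost_poly c.
(* Preparing the tape takes 2(n+1) steps for n = [size w], and so does each of the at most
   [a * n.+1 ^ k] sweeps and the final test. *)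
exists (2 * a + 4), k.+1 => w.
set code := decider_code c b; have sz : size code = (csize c).+1.
  by rewrite size_cat size_comp addn1.
have code_ok : all (instr_ok cfst cend code) code.
  rewrite /instr_ok sz all_cat /=; apply/and3P; split=> //.
    by apply: sub_all (comp_instr_ok c 0) => x /andP[-> /=]; lia.
  rewrite maxnE; apply/andP; split; last by lia.
  by apply/forallP => x; apply/forallP => d; rewrite /= !eqxx.
have [t lt_t rt] := comp_correct ok w init_store (pre := [::]) (erefl code).
rewrite add0n in rt.
have [] :=
    @nth_at _ (fun b c => (b, c), 0, 0) (comp 0 c) [::] (testf (TestB b), (csize c).+1, (csize c).+2) (csize c).
  by rewrite size_comp.
rewrite -/(decider_code c b) -/code => e lt.
have [e2 h2] := reach_trans rt (reach_step e lt (testf_enc w (TestB b) (den w c init_store))).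
exists ((size w + size w).+2 + (t + 1) * (size (enc w init_store) + size (enc w init_store))).
  rewrite size_mkseq expnS; have := leq_trans lt_t (hk _).
  have : 0 < (size w).+1 ^ k by rewrite expn_gt0.
  by move: (_ ^ k) => m; nia.
have okt := enc_tape_ok w init_store.
rewrite runD run_init ?init_tape_enc //.
rewrite (run_sweeps ini_cell code_ok e2 h2 okt) c_state_mconf /=.
by rewrite -sz; case: (flag _ b).
Qed.

(** * Propagation in Horn formulas *)

(** In a Horn formula at most one variable is added; a falsified clause without positive literal
    changes nothing and stays falsified. *)
Definition propagate (V : assignment) (D : clause) : assignment :=
  if sat_clause V D then V else fun v => V v || ((true, v) \in D).

Definition round (G : formula) (V : assignment) : assignment := foldl propagate V G.

Definition neg_vars (C1 C2 : clause) : assignment :=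
  fun v => ((false, v) \in C1) || ((false, v) \in C2).

Definition candidate (n : nat) (G : formula) (C1 C2 : clause) : assignment :=
  iter n (round G) (neg_vars C1 C2).

Definition witnesses (n : nat) (G : formula) (C1 C2 : clause) : bool :=
  let V := candidate n G C1 C2 in
  [&& ~~ sat_clause V C1, ~~ sat_clause V C2 & sat V G].

Lemma propagate_incl (V : assignment) D v : V v -> propagate V D v.
Proof. by rewrite /propagate; case: ifP => //= _ ->. Qed.

Lemma foldl_propagate_incl G (V : assignment) v : V v -> foldl propagate V G v.
Proof. by elim: G V => //= D G IH V Vv; apply/IH/propagate_incl. Qed.

(** All negative literals of [D] are false under [I], so [D] is satisfied by a positive literal, and
    there is only one. *)
Lemma horn_count D (I : assignment) v :
  count (fun l : literal => l.1) D <= 1 -> (true, v) \in D -> sat_clause I D ->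
  (forall u, (false, u) \in D -> I u) -> I v.
Proof.
move=> h vD /hasP[[[] u] uD /= Iu] neg; last by rewrite /sat_lit /= (neg _ uD) in Iu.
rewrite /sat_lit /= in Iu; suff [<-] : (true, u) = (true, v) :> literal by [].
elim: D h vD uD {neg} => //= -[b x] D IH h; rewrite !inE.
case: b h => /= [|h]; last exact: IH.
rewrite add1n ltnS leqn0 -leqn0 leqNgt -has_count => /hasPn none.
case/orP=> [/eqP ->|vD]; last by have := none _ vD.
by case/orP=> [/eqP //|uD]; have := none _ uD.
Qed.

Lemma propagate_below (V : assignment) D (I : assignment) :
  count (fun l : literal => l.1) D <= 1 -> sat_clause I D ->
  (forall v, V v -> I v) -> forall v, propagate V D v -> I v.
Proof.
move=> h ID VI v; rewrite /propagate; case: ifP => [_|/negbT VD]; first exact: VI.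
case/orP=> [|vD]; first exact: VI.
apply: (horn_count h vD ID) => u uD; apply: VI.
by move/hasPn: VD => /(_ _ uD); rewrite /sat_lit /= negbK.
Qed.

Lemma round_below G (V : assignment) (I : assignment) : horn G -> sat I G ->
  (forall v, V v -> I v) -> forall v, round G V v -> I v.
Proof.
rewrite /round; elim: G V => //= D G IH V /andP[hD hG] /andP[ID IG] VI.
by apply: IH => //; apply: propagate_below.
Qed.

(** The negative literals of [D] are false under [V], hence under [I] and throughout the round, so
    [I] satisfies [D] through its positive literal [v]. When the round reaches [D], either [D] is
    still false and [v] is added, or [D] has become true, which is possible only through [v]. *)
Lemma round_progress G (V : assignment) (I : assignment) D : horn G -> sat I G ->
  (forall v, V v -> I v) -> D \in G -> ~~ sat_clause V D ->
  exists v, [/\ (true, v) \in D, ~~ V v & round G V v].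
Proof.
move=> hG IG VI DG VD.
have ID : sat_clause I D by apply: (allP IG).
have hD := allP hG _ DG.
have [[[] v] vD /= Iv] := hasP ID; last first.
  move/hasPn: VD => /(_ _ vD); rewrite /sat_lit /= negbK => /VI Ivt.
  by rewrite /sat_lit /= Ivt in Iv.
exists v; split=> //; first by move/hasPn: VD => /(_ _ vD).
have Veq u : (false, u) \in D -> V u.
  by move=> uD; move/hasPn: VD => /(_ _ uD); rewrite /sat_lit /= negbK.
case/splitPr: DG => G1 G2; rewrite /round foldl_cat /=; apply: foldl_propagate_incl.
set V1 := foldl _ _ _; rewrite /propagate; case: ifP => [V1D|_]; last by rewrite vD orbT.
by apply: (horn_count hD vD V1D) => u /Veq; apply: foldl_propagate_incl.
Qed.

Lemma count_lt (T : eqType) (a b : pred T) s x :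
  (forall y, a y -> b y) -> x \in s -> ~~ a x -> b x -> count a s < count b s.
Proof.
move=> ab; elim: s => //= y s IH; rewrite inE => /orP[/eqP <-|xs] nax bx.
  by rewrite (negbTE nax) bx ltnS; apply: sub_count.
by rewrite -addnS leq_add ?IH //; case: (a y) (ab y) => // ->.
Qed.

(** The iterates stay below [I], which keeps the positive literals of [C1] and [C2] false, and above
    the initial assignment, which keeps the negative ones false. They reach a model of [G] because
    every unsuccessful round makes new variables true. *)
Lemma candidate_sat n G C1 C2 (I : assignment) : horn G -> size (flatten G) < n ->
  sat I G -> ~~ sat_clause I C1 -> ~~ sat_clause I C2 -> witnesses n G C1 C2.
Proof.
move=> hG ltn IG IC1 IC2; set V0 := neg_vars C1 C2.
have below k v : iter k (round G) V0 v -> I v.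
  elim: k v => [|k IH] v /=; last exact: round_below.
  case/orP=> [vC|vC]; [move/hasPn: IC1|move/hasPn: IC2]; move=> /(_ _ vC);
  by rewrite /sat_lit /= negbK.
have above k v : V0 v -> iter k (round G) V0 v.
  by move=> Vv; elim: k => //= k; apply: foldl_propagate_incl.
have falsify C : ~~ sat_clause I C -> (forall v, (false, v) \in C -> V0 v) ->
    ~~ sat_clause (candidate n G C1 C2) C.
  move=> IC CV; apply/hasPn => -[[] v] vC; rewrite /sat_lit /=.
    by apply: contra (hasPn IC _ vC); apply: below.
  by rewrite negbK; apply/above/CV.
rewrite /witnesses !falsify //=; first last.
- by move=> v vC; rewrite /V0 /neg_vars vC.
- by move=> v vC; rewrite /V0 /neg_vars vC orbT.
(* The measure counts the literal occurrences in [G] whose variable is true. It grows until a model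
   is reached, and [n] exceeds its largest possible value. *)
pose m k := count (fun l : literal => iter k (round G) V0 l.2) (flatten G).
have grow k : sat (iter k (round G) V0) G || (k <= m k).
  elim: k => [|k IH]; first by rewrite orbT.
  have [satk|satk] := boolP (sat (iter k (round G) V0) G).
    move: satk; rewrite iterS; move: (iter _ _ _) => V satV.
    suff -> : round G V = V by rewrite satV.
    rewrite /round; elim: (G) satV => //= D G' IH' /andP[VD VG].
    by rewrite {2}/propagate VD IH'.
  rewrite (negbTE satk) /= in IH; apply/orP; right; apply: leq_ltn_trans IH _.
  move: satk => /allPn[D DG nD].
  have [v [vD nv rv]] := round_progress hG IG (@below k) DG nD.
  apply: (@count_lt _ _ _ _ (true, v)) => //.
  - by move=> l; apply: foldl_propagate_incl.
  by apply/flattenP; exists D.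
case/orP: (grow n) => // le; move: (leq_trans le (count_size _ _)).
by rewrite leqNgt ltn.
Qed.

(** * Joint truth values of two formulas and equivalence of the orders *)

Definition active (b : bool) (F : formula) : formula := if b then F else [::].
(* The empty clause, false under all assignments, stands for the absence of a constraint. *)
Definition falsified (b : bool) (F : formula) : seq clause := if b then [:: [::]] else F.

Definition joint_sat (n : nat) (b1 b2 : bool) (F1 F2 : formula) : bool :=
  has (fun C1 => has (witnesses n (active b1 F1 ++ active b2 F2) C1) (falsified b2 F2))
    (falsified b1 F1).

Lemma falsifiedP b F (I : assignment) : sat I F = b ->
  exists2 C, C \in falsified b F & ~~ sat_clause I C.
Proof.
case: b => [_|/negbT /allPn [C CF nC]]; last by exists C.
by exists [::]; rewrite ?inE.
Qed.

Lemma falsified_sat b F (I : assignment) C : C \in falsified b F -> ~~ sat_clause I C ->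
  sat I (active b F) -> sat I F = b.
Proof. by case: b => //= CF nC _; apply/negbTE/allPn; exists C. Qed.

(** A successful candidate is itself the assignment sought. Conversely, an assignment [I] selects
    the clauses to falsify, and [candidate_sat] applies. *)
Lemma joint_satP n b1 b2 F1 F2 : horn F1 -> horn F2 ->
  size (flatten F1) + size (flatten F2) < n ->
  reflect (exists I, sat I F1 = b1 /\ sat I F2 = b2) (joint_sat n b1 b2 F1 F2).
Proof.
move=> h1 h2 lt; apply: (iffP hasP) => [[C1 m1 /hasP[C2 m2 /and3P[n1 n2]]]|[I [e1 e2]]].
  rewrite /sat all_cat => /andP[s1 s2]; exists (candidate n (active b1 F1 ++ active b2 F2) C1 C2).
  by split; [apply: falsified_sat m1 n1 s1|apply: falsified_sat m2 n2 s2].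
have [C1 m1 n1] := falsifiedP e1; have [C2 m2 n2] := falsifiedP e2.
exists C1 => //; apply/hasP; exists C2 => //; apply: candidate_sat n1 n2.
- by rewrite /horn all_cat; apply/andP; split; [case: (b1)|case: (b2)].
- by apply: leq_ltn_trans lt; rewrite flatten_cat size_cat leq_add //; [case: (b1)|case: (b2)].
by rewrite /sat all_cat; apply/andP; split; [case: b1 e1 {m1}|case: b2 e2 {m2}].
Qed.

(** The two orders differ at [I], [J] exactly when these agree on [F1] while [J] satisfies [F2] and
    [I] does not. *)
Lemma seq_equivP n F1 F2 : horn F1 -> horn F2 ->
  size (flatten F1) + size (flatten F2) < n ->
  reflect (seq_equiv [:: F1; F2] [:: F1])
    (~~ (joint_sat n true true F1 F2 && joint_sat n true false F1 F2) &&
     ~~ (joint_sat n false true F1 F2 && joint_sat n false false F1 F2)).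
Proof.
move=> h1 h2 lt.
have js b1 b2 := @joint_satP n b1 b2 F1 F2 h1 h2 lt.
apply: (iffP idP) => [/andP[nt nf] I J|eqv].
  rewrite /= /le_F.
  have ex b1 b2 K : sat K F1 = b1 -> sat K F2 = b2 -> joint_sat n b1 b2 F1 F2.
    by move=> e1 e2; apply/js; exists K.
  have := ex _ _ I erefl erefl; have := ex _ _ J erefl erefl.
  case: (sat I F1); case: (sat J F1); case: (sat I F2); case: (sat J F2) => //= eJ eI.
  - by rewrite eJ eI in nt.
  by rewrite eJ eI in nf.
have no b : ~~ (joint_sat n b true F1 F2 && joint_sat n b false F1 F2).
  apply/negP => /andP[/js[J [J1 J2]] /js[I [I1 I2]]].
  by have := eqv I J; rewrite /= /le_F I1 J1 I2 J2; case: (b).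
by rewrite !no.
Qed.

(** * Tokens *)

(* [inr false] is the end of a clause and [inr true] the end of a formula. *)
Definition token := (literal + bool)%type.

Definition enc_tok (t : token) : seq 'I_5 :=
  match t with inl l => enc_lit l | inr b => [:: sym_of_nat (b + 3)] end.
Definition enc_toks (ts : seq token) : seq 'I_5 := flatten (map enc_tok ts).

Definition toks (F : formula) : seq token :=
  flatten [seq rcons (map inl C) (inr false) | C <- F] ++ [:: inr true].

Lemma enc_toks_cat ts ts' : enc_toks (ts ++ ts') = enc_toks ts ++ enc_toks ts'.
Proof. by rewrite /enc_toks map_cat flatten_cat. Qed.

Lemma enc_toks1 t : enc_toks [:: t] = enc_tok t.
Proof. exact: cats0. Qed.

Lemma enc_formula_toks F : enc_formula F = enc_toks (toks F).
Proof.
rewrite /toks enc_toks_cat /enc_formula; congr (_ ++ _).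
elim: F => //= C F ->; rewrite enc_toks_cat; congr (_ ++ _).
rewrite /enc_clause -cats1 enc_toks_cat; congr (_ ++ _).
by elim: C => //= l C ->.
Qed.

Lemma val_sym k : k < 5 -> sym_of_nat k = k :> nat.
Proof. exact: inordK. Qed.

(** The default 4 is not a bit, so no literal starts beyond the end of [w]. *)
Definition symv (w : seq 'I_5) (i : nat) : nat := nth 4 (map (@nat_of_ord 5) w) i.

Lemma onth_sym w i k : k < 5 ->
  (onth w i == Some (sym_of_nat k)) = (i < size w) && (symv w i == k).
Proof.
move=> lt; have := onthTE w i; rewrite /symv; case: (ltnP i (size w)) => le.
  case E: (onth w i) => [a|] // _; rewrite (nth_map (sym_of_nat 4)) // -odflt_onth E /=.
  by rewrite -{2}(val_sym lt).
by case: onth.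
Qed.

(** A literal starts at a bit that does not follow a bit. The 4 put in front makes index [i] refer
    to the symbol before position [i] and lets position 0 qualify. *)
Definition lit_start (w : seq 'I_5) (i : nat) : bool :=
  (1 < nth 4 (4 :: map (@nat_of_ord 5) w) i) && (symv w i < 2).

Lemma enc_tokP t : exists e x,
  [/\ map (@nat_of_ord 5) (enc_tok t) = rcons e x, all (fun a => a < 2) e, 1 < x &
      match t with inl _ => 0 < size e /\ x = 2 | inr b => e = [::] /\ x = b + 3 end].
Proof.
case: t => [[b v]|b] /=.
  exists (map (@nat_of_ord 5) (enc_bit b :: enc_var v)), 2; split=> //.
    by rewrite /enc_lit /= map_cat /= cats1 val_sym.
  rewrite /= all_map /enc_var all_map.
  by rewrite val_sym; case: b => //=; apply/allP => -[] _; rewrite /= val_sym.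
exists [::], (b + 3); split=> //; last by rewrite addn3.
by rewrite val_sym //; case: b.
Qed.

Fixpoint positions (o : nat) (ts : seq token) : seq (nat * token) :=
  if ts is t :: ts1 then (o, t) :: positions (o + size (enc_tok t)) ts1 else [::].

Lemma positions_cat o ts ts' :
  positions o (ts ++ ts') = positions o ts ++ positions (o + size (enc_toks ts)) ts'.
Proof.
elim: ts o => [|t ts IH] o /=; first by rewrite addn0.
by rewrite IH /= size_cat addnA.
Qed.

Lemma positions_split k ts o t : (o, t) \in positions k ts ->
  exists ts1 ts2, ts = ts1 ++ t :: ts2 /\ o = k + size (enc_toks ts1).
Proof.
elim: ts k => //= t' ts IH k; rewrite inE => /orP[/eqP[-> ->]|].
  by exists [::], ts; rewrite addn0.
case/IH=> [ts1 [ts2 [-> ->]]]; exists (t' :: ts1), ts2; split=> //=.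
by rewrite size_cat addnA.
Qed.

Lemma size_enc_tok t : 0 < size (enc_tok t).
Proof. by case: t. Qed.

Lemma positions_ge k ts o t : (o, t) \in positions k ts -> k <= o.
Proof. by case/positions_split => [? [? [_ ->]]]; rewrite leq_addr. Qed.

Lemma positions_inj k ts o t t' :
  (o, t) \in positions k ts -> (o, t') \in positions k ts -> t = t'.
Proof.
elim: ts k => //= t1 ts IH k; rewrite !inE => /orP[/eqP[-> ->]|h] /orP[/eqP[]|h'].
- by [].
- by have := positions_ge h'; have := size_enc_tok t1; lia.
- by move=> e _; move: h; rewrite e => /positions_ge; have := size_enc_tok t1; lia.
exact: IH h h'.
Qed.

Lemma positions_lt ts o t : (o, t) \in positions 0 ts -> o < size (enc_toks ts).
Proof.
case/positions_split => [ts1 [ts2 [-> ->]]]; rewrite enc_toks_cat size_cat /= size_cat.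
by have := size_enc_tok t; lia.
Qed.

Lemma last_enc_toks ts : 1 < last 4 (map (@nat_of_ord 5) (enc_toks ts)).
Proof.
elim/last_ind: ts => // ts t _; rewrite -cats1 enc_toks_cat map_cat last_cat.
have [e [x [E _ gt _]]] := enc_tokP t.
by rewrite enc_toks1 E last_rcons.
Qed.

(** What precedes a token is the terminator of another token or the artificial leading 4, never a
    bit; so a literal start is seen exactly when the token begins with a bit. *)
Lemma token_head ts1 t ts2 : let w := enc_toks (ts1 ++ t :: ts2) in
  let i := size (enc_toks ts1) in
  [/\ lit_start w i = (if t is inl _ then true else false), i < size w &
      if t is inr b then symv w i = b + 3 else true].
Proof.
move=> w i; have [e [x [E le2 gt et]]] := enc_tokP t.
have hd : (head x e < 2) = (if t is inl _ then true else false).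
  case: (t) et => [l|b] []; last by move=> -> -> /=; rewrite addn3.
  by case: (e) le2 => //= a e' /andP[].
have szi : i = size (map (@nat_of_ord 5) (enc_toks ts1)) by rewrite size_map.
have ew : map (@nat_of_ord 5) w =
    map (@nat_of_ord 5) (enc_toks ts1) ++ rcons e x ++ map (@nat_of_ord 5) (enc_toks ts2).
  by rewrite /w enc_toks_cat map_cat /= map_cat E.
have vi : symv w i = head x e.
  by rewrite /symv ew nth_cat szi ltnn subnn; case: (e).
split.
- rewrite /lit_start vi -[4 :: _]cat1s ew catA nth_cat /= szi ltnS leqnn.
  rewrite -[X in nth _ _ X]/((size (4 :: map (@nat_of_ord 5) (enc_toks ts1))).-1) nth_last /=.
  by rewrite last_enc_toks hd.
- by rewrite /w enc_toks_cat size_cat /= size_cat; have := size_enc_tok t; lia.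
by rewrite vi; case: (t) et => // b [-> ->].
Qed.

(** All symbols of a token but the last are bits, so an inner position follows a bit. Only literals
    have inner positions, and these hold bits or the terminator 2. *)
Lemma token_inner ts1 t ts2 i : let w := enc_toks (ts1 ++ t :: ts2) in
  size (enc_toks ts1) < i < size (enc_toks ts1) + size (enc_tok t) ->
  ~~ lit_start w i /\ symv w i < 3.
Proof.
move=> w /andP[gti lti]; have [e [x [E le2 gt et]]] := enc_tokP t.
have ew : map (@nat_of_ord 5) w =
    map (@nat_of_ord 5) (enc_toks ts1) ++ rcons e x ++ map (@nat_of_ord 5) (enc_toks ts2).
  by rewrite /w enc_toks_cat map_cat /= map_cat E.
have lti' : i - size (enc_toks ts1) <= size e.
  by move/(congr1 size): E; rewrite size_map size_rcons; lia.
have le2n j : j < size e -> nth 4 e j < 2 by move=> lt; apply: (all_nthP _ le2).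
have pos : exists k, [/\ i = size (enc_toks ts1) + k.+1 & k < size e].
  by exists (i - size (enc_toks ts1)).-1; split; lia.
have [k [ei ltk]] := pos; split.
  rewrite /lit_start ei addnS /= ew nth_cat size_map ifN -?leqNgt ?leq_addr // addKn.
  by rewrite -cats1 -catA nth_cat ltk; have := le2n _ ltk; case: (nth _ _ _) => [|[|]].
rewrite /symv ew nth_cat size_map ei ifN -?leqNgt ?leq_addr // addKn nth_cat size_rcons.
rewrite [k.+1 < _]ltnS ltk nth_rcons; case: ifP => [lt|nlt]; first by have := le2n _ lt; lia.
case: t et {E w ew lti} => [l [_ ->]|b [e0]]; last by rewrite e0 in ltk.
by case: eqP nlt => //; lia.
Qed.

(* Pointers: 0-2 clause loops, 3 literals of a clause, 4 occurrences of a variable, 5-7 comparison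
   of variables, 8 rounds, 9 initial pass.  Sets: 0 literal starts, 1 current assignment, 2-4 current
   clauses.  Flags: 0 token start, 1-2 comparison of variables, 3 satisfied clause, 4-6 second formula
   reached, 7 candidate still valid, 8-11 joint satisfiability results, 12 answer. *)
Local Notation vr k := (@Ordinal 16 k isT).
Local Notation vL := (vr 0).

(** * Loops over tokens *)

Definition Tok p cl cc cf :=
  If (InA vL p) cl (If (SymAt p (sym_of_nat 3)) cc (If (SymAt p (sym_of_nat 4)) cf Skip)).

Local Arguments den : simpl never.

Lemma den_skip w s : den w Skip s = s. Proof. by []. Qed.
Lemma den_op w o s : den w (Op o) s = oden o s. Proof. by []. Qed.
Lemma den_seq w c1 c2 s : den w (Seq c1 c2) s = den w c2 (den w c1 s). Proof. by []. Qed.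
Lemma den_if w t c1 c2 s :
  den w (If t c1 c2) s = if tden w t s then den w c1 s else den w c2 s.
Proof. by []. Qed.
Definition denE := (den_skip, den_op, den_seq, den_if).

Definition on_token T (cl cc cf : T) (t : token) : T :=
  match t with inl _ => cl | inr false => cc | inr true => cf end.

Lemma den_Tok_head ts1 t ts2 p cl cc cf s : let w := enc_toks (ts1 ++ t :: ts2) in
  pset s vL =1 lit_start w -> ptr s p = size (enc_toks ts1) ->
  den w (Tok p cl cc cf) s = den w (on_token cl cc cf t) s.
Proof.
move=> w AL Pp; have := token_head ts1 t ts2; rewrite /= -/w => -[hl lt ht].
rewrite /Tok !denE /= AL Pp hl (ltnW lt) /= !onth_sym // lt /=.
by case: (t) ht => [l|[]] // ->.
Qed.

Lemma den_Tok_inner ts1 t ts2 p cl cc cf s : let w := enc_toks (ts1 ++ t :: ts2) in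
  pset s vL =1 lit_start w ->
  size (enc_toks ts1) < ptr s p < size (enc_toks ts1) + size (enc_tok t) ->
  den w (Tok p cl cc cf) s = s.
Proof.
move=> w AL Pp; have := token_inner ts2 Pp; rewrite /= -/w => -[/negbTE hl lt].
rewrite /Tok !denE /= AL hl andbF /= !onth_sym //.
by rewrite !(ltn_eqF _) ?andbF //; lia.
Qed.

(** A loop over positions becomes a loop over tokens, as [Tok] acts at the head of a token and is
    idle inside it. The invariant must not depend on the loop pointer, which also moves at idle
    positions. *)
Lemma for_tok_inv ts (w := enc_toks ts) (J : seq (nat * token) -> store -> Prop) p cl cc cf s :
  (forall d s, J d s -> pset s vL =1 lit_start w) ->
  (forall d s i, J d s -> J d (updP s p i)) ->
  J [::] s ->
  (forall d o t s, (o, t) \in positions 0 ts -> J d s -> ptr s p = o ->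
     J (rcons d (o, t)) (den w (on_token cl cc cf t) s)) ->
  J (positions 0 ts) (den w (For p (Tok p cl cc cf)) s).
Proof.
move=> JL JP J0 JS; rewrite /den -/den; apply: (JP).
set f := foldl _; have f1 s0 k : f s0 (iota k 1) = den w (Tok p cl cc cf) (updP s0 p k) by [].
(* The tokens [ts1] have been treated; the positions left are those of [ts2]. *)
suff main ts1 ts2 s' : ts1 ++ ts2 = ts -> J (positions 0 ts1) s' ->
    J (positions 0 ts) (f s' (iota (size (enc_toks ts1)) (size (enc_toks ts2)))).
  exact: (main [::] ts).
elim: ts2 ts1 s' => [|t ts2 IH] ts1 s' e Js'; first by rewrite -e cats0.
have sz : size (enc_toks (t :: ts2)) = size (enc_tok t) + size (enc_toks ts2).
  by rewrite /enc_toks /= size_cat.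
rewrite sz iotaD /f foldl_cat -/f.
have := IH (rcons ts1 t); rewrite -cats1 enc_toks_cat size_cat enc_toks1.
apply; first by rewrite -catA.
rewrite positions_cat /= cats1 add0n.
have step : forall m, m < size (enc_tok t) ->
    J (rcons (positions 0 ts1) (size (enc_toks ts1), t))
      (f s' (iota (size (enc_toks ts1)) m.+1)).
  elim=> [|m IHm] lt; last first.
    have := IHm (ltnW lt); rewrite -[m.+2]addn1 iotaD /f foldl_cat -/f.
    move: (f s' _) => s1 Js1; rewrite f1 /w -e den_Tok_inner ?e //=; first exact: JP.
    - by apply: JL Js1.
    - by rewrite eqxx; lia.
  rewrite f1 /w -e den_Tok_head ?e /=; last by rewrite eqxx.
    apply: JS; [|exact: JP|by rewrite /= eqxx].
    by rewrite -e positions_cat mem_cat /= inE eqxx orbT.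
  by apply: JL Js'.
by case: (size (enc_tok t)) (size_enc_tok t) step => // m _; apply.
Qed.

(** * The program *)

Local Notation bit0 := (sym_of_nat 0).
Local Notation bit1 := (sym_of_nat 1).

(** Flag 0 remembers that the preceding symbol is not a bit; it starts as true in agreement with the
    leading 4 of [lit_start]. *)
Definition mark_literals : cmd :=
  let bit := Seq (If (TestB (vr 0)) (Op (Put vL (vr 9))) Skip) (Op (SetB (vr 0) false)) in
  Seq (Op (Clear vL)) (Seq (Op (SetB (vr 0) true))
    (For (vr 9) (If (SymAt (vr 9) bit0) bit
                (If (SymAt (vr 9) bit1) bit (Op (SetB (vr 0) true)))))).

Lemma mark_literalsP w s : pset (den w mark_literals s) vL =1 lit_start w.
Proof.
rewrite /mark_literals !denE.
pose J i (s : store) := flag s (vr 0) = (1 < nth 4 (4 :: map (@nat_of_ord 5) w) i) /\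
  forall j, pset s vL j = (j < i) && lit_start w j.
set s0 := oden _ _.
set c := If _ _ _; have [] : J (size w) (den w (For (vr 9) c) s0); first apply: for_inv.
- by [].
- move=> i s1 lt [Jb JA]; rewrite /c !denE /= !onth_sym // lt /=; split.
    rewrite [nth _ _ _]/=  -/(symv w i).
    by case: (symv w i) => [|[|k]] //=; case: (flag s1 (vr 0)).
  move=> j; have old : j != i -> (j < i.+1) && lit_start w j = pset s1 vL j.
    by move=> ne; rewrite JA ltnS leq_eqVlt (negbTE ne).
  have lsE : lit_start w i = flag s1 (vr 0) && (symv w i < 2) by rewrite Jb.
  have [->|ne] := eqVneq j i.
    have nA : pset s1 vL i = false by rewrite JA ltnn.
    rewrite ltnSn lsE; case: (symv w i) => [|[|k]] /=; case: (flag s1 (vr 0));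
    by rewrite /= ?nA ?eqxx ?andbF.
  rewrite old //; case: (symv w i) => [|[|k]] /=; case: (flag s1 (vr 0)) => //=;
  by rewrite eq_sym (negbTE ne) orbF.
- by [].
move=> _ h j; rewrite h; case: ltnP => //= le.
by rewrite /lit_start [symv w j]nth_default ?size_map // andbF.
Qed.

(* The outcome is left in flag 1; flag 2 is lowered once it is known. *)
Definition same_var (p q : var) : cmd :=
  let fail := Seq (Op (SetB (vr 2) false)) (Op (SetB (vr 1) false)) in
  let advance := Seq (Op (IncP (vr 5))) (Op (IncP (vr 6))) in
  Seq (Op (CopyP (vr 5) p)) (Seq (Op (CopyP (vr 6) q)) (Seq advance
  (Seq (Op (SetB (vr 1) true)) (Seq (Op (SetB (vr 2) true))
  (For (vr 7) (If (TestB (vr 2))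
     (If (SymAt (vr 5) bit0) (If (SymAt (vr 6) bit0) advance fail)
     (If (SymAt (vr 5) bit1) (If (SymAt (vr 6) bit1) advance fail)
     (If (SymAt (vr 6) (sym_of_nat 2)) (Op (SetB (vr 2) false)) fail)))
     Skip)))))).

Lemma drop_onth (T : Type) (w : seq T) i a y : drop i w = a :: y ->
  onth w i = Some a /\ drop i.+1 w = y.
Proof.
by elim: w i => [|b w IH] [|i] //=; [move=> [-> ->]; rewrite drop0|apply: IH].
Qed.

Lemma enc_bit_inj : injective enc_bit.
Proof.
by move=> a b /(congr1 (@nat_of_ord 5)); rewrite !val_sym; case: a; case: b.
Qed.

Lemma enc_var_inj : injective enc_var.
Proof.
move=> v u /(inj_map enc_bit_inj) e; apply: Pnat.SuccNat2Pos.inj.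
elim: (BinPos.Pos.of_succ_nat v) (BinPos.Pos.of_succ_nat u) e => [p IH|p IH|] [q|q|] //=.
  by case=> /IH ->.
by case=> /IH ->.
Qed.

Lemma sym_eq j k : j < 5 -> k < 5 ->
  (Some (sym_of_nat j) == Some (sym_of_nat k)) = (j == k).
Proof. by move=> lj lk; rewrite -[LHS]/(sym_of_nat j == sym_of_nat k :> nat) !val_sym. Qed.

(** Pointer [q] is copied after pointer 5 has been overwritten, hence the condition on [q]. *)
Lemma same_varP w s p q (l l' : literal) x x' :
  drop (ptr s p) w = enc_lit l ++ x -> drop (ptr s q) w = enc_lit l' ++ x' ->
  q != vr 5 ->
  flag (den w (same_var p q) s) (vr 1) = (l.2 == l'.2).
Proof.
move=> e e' q5.
(* While flag 2 is up, the answer depends on the unread bits [y] and [y'] only. The bound on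
   [i + size y] fails at [i = size w], so the loop is long enough to settle the answer. *)
pose J i (s : store) :=
  if flag s (vr 2) then flag s (vr 1) /\ exists y y' z z',
    [/\ drop (ptr s (vr 5)) w = map enc_bit y ++ sym_of_nat 2 :: z,
        drop (ptr s (vr 6)) w = map enc_bit y' ++ sym_of_nat 2 :: z',
        (l.2 == l'.2) = (y == y') & i + size y < size w]
  else flag s (vr 1) = (l.2 == l'.2).
have JE i s1 : i = size w -> J i s1 -> flag s1 (vr 1) = (l.2 == l'.2).
  rewrite /J => ->; case: ifP => // _ [_ [y [? [? [? [_ _ _]]]]]].
  by rewrite ltnNge leq_addr.
rewrite /same_var !denE; apply: JE; first by [].
apply: for_inv; last by [].
  rewrite /J /= (negbTE q5).
  have next i l0 x0 : drop i w = enc_lit l0 ++ x0 -> drop i.+1 w = enc_var l0.2 ++ sym_of_nat 2 :: x0.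
    by move=> e0; have [_ ->] := drop_onth e0; rewrite [LHS]/= -[RHS]/(_ ++ [:: _] ++ _) catA.
  split=> //; exists (pos_bits (BinPos.Pos.of_succ_nat l.2)),
    (pos_bits (BinPos.Pos.of_succ_nat l'.2)), x, x'.
  rewrite (next _ _ _ e) (next _ _ _ e') -(inj_eq enc_var_inj) -(inj_eq (inj_map enc_bit_inj)); split=> //.
  have : size (drop (ptr s p) w) <= size w by rewrite size_drop leq_subr.
  by rewrite e /= !size_cat size_map /=; lia.
move=> i s1 lt; rewrite /J !denE [tden _ (TestB _) _]/=.
case E: (flag s1 (vr 2)); last by rewrite E.
case=> eq1 [y [y' [z [z' [dy dy' eyy lty]]]]].
case: y dy eyy lty => [|b y] dy eyy lty.
  have [o5 d5] := drop_onth dy.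
  rewrite /= o5 /= !sym_eq //=.
  case: y' dy' eyy => [|b' y'] dy' eyy; have [o6 d6] := drop_onth dy'.
    by rewrite /= o6 /= !sym_eq //= eyy eq1.
  rewrite /= o6 /= /enc_bit !sym_eq //; last by case: b' {dy' eyy o6}.
  by case: b' {dy' o6} eyy => //= ->.
have [o5 d5] := drop_onth dy; rewrite [size _]/= addnS in lty.
case: y' dy' eyy => [|b' y'] dy' eyy; have [o6 d6] := drop_onth dy'.
  by case: b {dy} o5 eyy => o5 eyy; rewrite /= o5 o6 /= /enc_bit !sym_eq //= eyy.
case: b b' {dy dy'} o5 o6 eyy => [] [] o5 o6 eyy;
  rewrite /= o5 o6 /= /enc_bit !sym_eq //= ?E; split=> //;
  by exists y, y', z, z'.
Qed.

(** * Assignments and clauses held in registers *)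

Local Notation vT := (vr 1).
Local Notation vcs := (vr 3).

(* Register [vT] represents an assignment by the positions of the literals over its true variables. *)
Definition represents (ts : seq token) (s : store) (V : assignment) : Prop :=
  forall o (l : literal), (o, inl l) \in positions 0 ts -> pset s vT o = V l.2.

Definition occurs (ts : seq token) (D : seq (nat * literal)) : Prop :=
  forall x, x \in D -> (x.1, inl x.2) \in positions 0 ts.

Lemma positions_drop ts o (l : literal) : (o, inl l) \in positions 0 ts ->
  exists x, drop o (enc_toks ts) = enc_lit l ++ x.
Proof.
case/positions_split => [ts1 [ts2 [-> ->]]]; exists (enc_toks ts2).
by rewrite enc_toks_cat drop_size_cat.
Qed.

Lemma positions_bit ts o (l : literal) b : (o, inl l) \in positions 0 ts ->
  (onth (enc_toks ts) o == Some (enc_bit b)) = (l.1 == b).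
Proof.
move=> h; have [x e] := positions_drop h; have [-> _] := drop_onth e.
by rewrite /enc_bit sym_eq; case: b; case: l.1.
Qed.

(** As [vT] is indexed by literal positions, making a variable true means marking all its
    occurrences in both formulas. *)
Definition mark_var (q : var) : cmd :=
  For (vr 4) (Tok (vr 4)
    (Seq (same_var (vr 4) q) (If (TestB (vr 1)) (Op (Put vT (vr 4))) Skip)) Skip Skip).

Lemma mark_varP ts s (q : var) o (l : literal) V : ~~ (3 < q < 8) ->
  pset s vL =1 lit_start (enc_toks ts) -> ptr s q = o -> (o, inl l) \in positions 0 ts ->
  represents ts s V ->
  represents ts (den (enc_toks ts) (mark_var q) s) (fun v => V v || (v == l.2)).
Proof.
move=> qr AL Pq ol rV.
have nq k : 3 < k -> k < 8 -> q == k :> nat = false by move=> h1 h2; apply/eqP; lia.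
pose J (d : seq (nat * token)) s := [/\ pset s vL =1 lit_start (enc_toks ts), ptr s q = o &
  forall o' (l' : literal), (o', inl l') \in positions 0 ts ->
    pset s vT o' = V l'.2 || ((o', inl l') \in d) && (l'.2 == l.2)].
suff [_ _ h] : J (positions 0 ts) (den (enc_toks ts) (mark_var q) s).
  by move=> o' l' h'; rewrite (h _ _ h') h'.
apply: for_tok_inv.
- by move=> d s1 [].
- by move=> d s1 i [h1 h2 h3]; split=> //=; rewrite -val_eqE /= nq.
- by split=> // o' l' h; rewrite orbF (rV _ _ h).
move=> d o1 t s1 h1 [AL1 P1 Jd] Po1.
case: t h1 => [l1|b] h1; last first.
  suff -> : den (enc_toks ts) (on_token (Seq (same_var (vr 4) q)
    (If (TestB (vr 1)) (Op (Put vT (vr 4))) Skip)) Skip Skip (inr b)) s1 = s1.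
    by split=> // o' l' h; rewrite mem_rcons inE (Jd _ _ h) xpair_eqE andbF.
  by case: b {h1}.
have [x ex] := positions_drop h1; have [x' ex'] := positions_drop ol.
rewrite -Po1 in ex; rewrite -P1 in ex'.
rewrite /on_token den_seq den_if [tden _ _ _]/= (same_varP ex ex'); last by rewrite -val_eqE /= nq.
set s2 := den _ (same_var _ _) _.
have A2 : pset s2 =1 pset s1 by move=> a; rewrite /s2 frameA.
have P2 (p : var) : ~~ (4 < p < 8) -> ptr s2 p = ptr s1 p.
  by move=> np; rewrite /s2 frameP //= -!val_eqE /= !orbF; lia.
have P2q : ptr s2 q = o by rewrite P2 //; lia.
have in1 o' (l' : literal) : (o', inl l') \in positions 0 ts ->
    (o', inl l') == (o1, inl l1) :> nat * token = (o' == o1).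
  move=> h'; apply/eqP/eqP => [[]//|eo]; rewrite eo in h' *.
  by rewrite (positions_inj h' h1).
clearbody s2; rewrite !denE; case: eqP => el; split=> //=; rewrite ?A2 //.
  move=> o' l' h'; rewrite P2 // Po1 (Jd _ _ h') mem_rcons inE in1 // andb_orl -orbA.
  congr orb; rewrite orbC [o1 == _]eq_sym; congr orb.
  have [eo|//] := eqVneq o' o1; rewrite eo in h'.
  by have [->] := positions_inj h' h1; rewrite el eqxx.
move=> o' l' h'; rewrite (Jd _ _ h') mem_rcons inE in1 //.
have [eo|//] := eqVneq o' o1; rewrite eo in h'.
have [->] := positions_inj h' h1.
by move/eqP/negbTE: el => ->; rewrite /= !andbF.
Qed.

Definition clause_set (s : store) (K : var) (D : seq (nat * literal)) : Prop :=
  pset s K =1 (fun i => i \in map fst D).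

(** The part of the clause [D] that a loop has met after the tokens [d], in the order of the
    input. *)
Definition lits_at (D : seq (nat * literal)) (d : seq (nat * token)) : seq literal :=
  pmap (fun x : nat * token =>
    if x.2 is inl l then if x.1 \in map fst D then Some l else None else None) d.

Lemma lits_at_positions ts D : occurs ts D -> lits_at D (positions 0 ts) =i map snd D.
Proof.
move=> oD l; rewrite /lits_at mem_pmap; apply/mapP/mapP.
  case=> [[o [l0|//]] h /=]; case: ifP => // /mapP[[o' l'] h' /= eo] [->].
  exists (o', l') => //=; have := oD _ h'; rewrite /= -eo => h2.
  by have [] := positions_inj h h2.
case=> [[o l'] h /= ->]; exists (o, inl l'); first exact: oD h.
by rewrite /= ifT //; apply/mapP; exists (o, l').
Qed.

Definition for_clause (K : var) (c : cmd) : cmd :=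
  For (vr 3) (Tok (vr 3) (If (InA K (vr 3)) c Skip) Skip Skip).

(** With [b] false this collects the variables of the initial candidate; with [b] true it performs a
    propagation. *)
Definition add_vars (b : bool) (K : var) : cmd :=
  for_clause K (If (SymAt (vr 3) (enc_bit b)) (mark_var (vr 3)) Skip).

Definition eval_clause (K : var) : cmd :=
  let sat := Op (SetB vcs true) in
  Seq (Op (SetB vcs false))
    (for_clause K (If (SymAt (vr 3) bit0) (If (InA vT (vr 3)) Skip sat)
                                          (If (InA vT (vr 3)) sat Skip))).

(** The loop meets the literals in input order, so they agree with [D] only up to [=i]; this
    suffices for membership and satisfaction. *)
Lemma for_clauseP ts (w := enc_toks ts) K c D s (J : seq literal -> store -> Prop) :
  ~~ modA c vL -> ~~ modA c K ->
  pset s vL =1 lit_start w -> clause_set s K D -> occurs ts D ->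
  (forall C s i, J C s -> J C (updP s (vr 3) i)) ->
  J [::] s ->
  (forall C o l s, (o, inl l) \in positions 0 ts -> ptr s (vr 3) = o ->
    pset s vL =1 lit_start w -> J C s -> J (rcons C l) (den w c s)) ->
  exists2 C, C =i map snd D & J C (den w (for_clause K c) s).
Proof.
move=> mL mK AL AK oD JP J0 JS.
pose JJ (d : seq (nat * token)) (s : store) :=
  [/\ pset s vL =1 lit_start w, clause_set s K D & J (lits_at D d) s].
suff [_ _ h] : JJ (positions 0 ts) (den w (for_clause K c) s).
  by exists (lits_at D (positions 0 ts)); first exact: lits_at_positions.
apply: for_tok_inv.
- by move=> d s1 [].
- by move=> d s1 i [h1 h2 h3]; split=> //; apply: JP.
- by [].
move=> d o t s1 h [h1 h2 h3] Po.
have lits_rcons : lits_at D (rcons d (o, t)) =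
    if t is inl l then if o \in map fst D then rcons (lits_at D d) l else lits_at D d
    else lits_at D d.
  rewrite /lits_at -cats1 pmap_cat /=; case: (t) => [l|b] /=; last by rewrite cats0.
  by case: ifP => _; rewrite /= ?cats1 ?cats0.
rewrite /JJ lits_rcons.
case: t h {lits_rcons} => [l|b] h; last by case: b {h}.
rewrite /on_token den_if /= Po h2 (ltnW (positions_lt h)) /=.
case: ifP => oK //.
split; first by rewrite frameA.
  by rewrite /clause_set frameA.
exact: JS h Po h1 h3.
Qed.

Lemma add_varsP ts (w := enc_toks ts) b (K : var) D s V : vT < K ->
  pset s vL =1 lit_start w -> clause_set s K D -> occurs ts D -> represents ts s V ->
  represents ts (den w (add_vars b K) s) (fun v => V v || ((b, v) \in map snd D)).
Proof.
move=> ltK AL AK oD rV.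
have [|||||C eC rC] := @for_clauseP ts K (If (SymAt (vr 3) (enc_bit b)) (mark_var (vr 3)) Skip)
  D s (fun C s => represents ts s (fun v => V v || ((b, v) \in C))) _ _ AL AK oD.
- by [].
- by rewrite /= !orbF; apply/eqP => e; rewrite e in ltK.
- by [].
- by move=> o l h; rewrite orbF (rV _ _ h).
- move=> C o l s1 h Po AL1 r1; rewrite den_if /= Po (positions_bit _ h).
  case: eqP => [eb|nb]; move=> o' l' h'.
    have -> := mark_varP (isT : ~~ (3 < vr 3 < 8)) AL1 Po h r1 h'.
    rewrite mem_rcons inE -orbA; congr orb; rewrite orbC; congr orb.
    by rewrite (surjective_pairing l) xpair_eqE -eb eqxx.
  rewrite ?den_skip (r1 _ _ h') mem_rcons inE [X in _ || (X || _)](_ : _ = false) //.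
  by apply/eqP => e; case: nb; rewrite -e.
by move=> o l h; rewrite (rC _ _ h) eC.
Qed.

Lemma eval_clauseP ts (w := enc_toks ts) (K : var) D s (V : assignment) : vT < K ->
  pset s vL =1 lit_start w -> clause_set s K D -> occurs ts D -> represents ts s V ->
  flag (den w (eval_clause K) s) vcs = sat_clause V (map snd D).
Proof.
move=> ltK AL AK oD rV; rewrite den_seq.
set c := If _ _ _; set s0 := den _ (Op _) _.
have [|||||C eC [_ ->]] := @for_clauseP ts K c D s0
  (fun C s => represents ts s V /\ flag s vcs = sat_clause V C) _ _ AL AK oD.
- by [].
- by [].
- by [].
- by [].
- move=> C o l s1 h Po AL1 [r1 e1].
  rewrite /c !denE /= Po (positions_bit false h) (r1 _ _ h) (ltnW (positions_lt h)) /=.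
  rewrite /sat_clause has_rcons [sat_lit V l]/sat_lit -/(sat_clause V C) -e1.
  by case: l.1 => /=; case: (V l.2).
by rewrite /sat_clause (eq_has_r eC).
Qed.

(* Parsing state: whether the first formula is over, the literals of the current clause,
   and the complete clauses, tagged with [true] if they belong to the second formula. *)
Definition parse_state : Type :=
  bool * seq (nat * literal) * seq (bool * seq (nat * literal)).

Definition parse_step (x : parse_state) (y : nat * token) : parse_state :=
  let: (fm, cur, done) := x in
  match y.2 with
  | inl l => (fm, rcons cur (y.1, l), done)
  | inr false => (fm, [::], rcons done (fm, cur))
  | inr true => (true, cur, done)
  end.

Definition parse (d : seq (nat * token)) : parse_state :=
  foldl parse_step (false, [::], [::]) d.

Definition clauses (f : bool) (d : seq (nat * token)) : seq (seq (nat * literal)) :=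
  [seq x.2 | x <- (parse d).2 & x.1 == f].

Lemma parse_toks fm o done F ts' : exists o' done',
  foldl parse_step (fm, [::], done) (positions o (toks F ++ ts')) =
    foldl parse_step (true, [::], done ++ done') (positions o' ts') /\
  [seq (x.1, map snd x.2) | x <- done'] = [seq (fm, C) | C <- F].
Proof.
have clause C cur rest o1 done1 : exists o' cur',
    foldl parse_step (fm, cur, done1) (positions o1 (rcons (map inl C) (inr false) ++ rest)) =
    foldl parse_step (fm, [::], rcons done1 (fm, cur ++ cur')) (positions o' rest) /\
    map snd cur' = C.
  elim: C cur o1 => [|l C IH] cur o1 /=.
    by exists (o1 + 1), [::]; rewrite cats0.
  have [o' [cur' [-> <-]]] := IH (rcons cur (o1, l)) (o1 + size (enc_lit l)).
  by exists o', ((o1, l) :: cur'); rewrite cat_rcons.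
rewrite /toks; elim: F o done => [|C F IH] o done /=.
  by exists (o + 1), [::]; rewrite cats0.
rewrite -!catA; have [o1 [cur [-> eC]]] := clause C [::]
  (flatten [seq rcons [seq inl i | i <- C] (inr false) | C <- F] ++ [:: inr true] ++ ts') o done.
have [o2 [done' [e2 e3]]] := IH o1 (rcons done (fm, cur)).
exists o2, ((fm, cur) :: done'); rewrite /= -e3 eC -(cat_rcons (fm, cur)) -e2; split=> //.
by rewrite -catA.
Qed.

Lemma clauses_pair f F1 F2 :
  map (map snd) (clauses f (positions 0 (toks F1 ++ toks F2))) = if f then F2 else F1.
Proof.
rewrite /clauses /parse.
have [o1 [d1 [-> e1]]] := parse_toks false 0 [::] F1 (toks F2).
have [o2 [d2 []]] := parse_toks true o1 ([::] ++ d1) F2 [::].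
rewrite cats0 => -> e2 /=.
have sel b (g : bool) F (d : seq (bool * seq (nat * literal))) :
    [seq (x.1, map snd x.2) | x <- d] = [seq (g, C) | C <- F] ->
    map (map snd) [seq x.2 | x <- d & x.1 == b] = if g == b then F else [::].
  elim: d F => [|[g' D] d IH] [|C F] //=; first by case: ifP.
  by case=> -> <- /IH; case: (g == b) => //= ->.
rewrite filter_cat !map_cat (sel f _ _ _ e1) (sel f _ _ _ e2).
by case: f => /=; rewrite ?cats0.
Qed.

(** Register [K] accumulates the literal positions of the current clause; [c] runs at the
    end-of-clause mark, when [K] holds the whole clause, and [K] is then emptied. *)
Definition each_clause (f : bool) (p K fm : var) (c : cmd) : cmd :=
  Seq (Op (Clear K)) (Seq (Op (SetB fm false))
    (For p (Tok p (Op (Put K p))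
      (Seq (if f then If (TestB fm) c Skip else If (TestB fm) Skip c) (Op (Clear K)))
      (Op (SetB fm true))))).

(** The loop simulates [parse] in [K] and [fm]. The invariant must be insensitive to [p], [K] and
    [fm], so nested loops get registers of their own. *)
Lemma each_clauseP ts (w := enc_toks ts) f p K fm c s
    (J : seq (seq (nat * literal)) -> store -> Prop) :
  vL != K -> ~~ modA c vL -> ~~ modB c fm -> pset s vL =1 lit_start w ->
  (forall Ds s i, J Ds s -> J Ds (updP s p i)) ->
  (forall Ds s X, J Ds s -> J Ds (updA s K X)) ->
  (forall Ds s b, J Ds s -> J Ds (updB s fm b)) ->
  J [::] s ->
  (forall Ds D s, occurs ts D -> pset s vL =1 lit_start w -> clause_set s K D -> J Ds s ->
    J (rcons Ds D) (den w c s)) ->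
  J (clauses f (positions 0 ts)) (den w (each_clause f p K fm c) s).
Proof.
move=> nK mA mB AL JP JA JB J0 JS.
pose JJ (d : seq (nat * token)) (s : store) :=
  [/\ pset s vL =1 lit_start w, flag s fm = (parse d).1.1, clause_set s K (parse d).1.2,
      occurs ts (parse d).1.2 & J (clauses f d) s].
suff [] : JJ (positions 0 ts) (den w (each_clause f p K fm c) s) by [].
rewrite /each_clause !den_seq; apply: for_tok_inv.
- by move=> d s1 [].
- by move=> d s1 i [h1 h2 h3 h4 h5]; split=> //; apply: (JP).
- split=> //=.
  + by rewrite (negbTE nK).
  + by rewrite eqxx.
  + by move=> i; rewrite /= eqxx.
  + exact: JB (JA _ _ _ J0).
move=> d o t s1 h [h1 h2 h3 h4 h5] Po; rewrite /JJ /clauses.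
have -> : parse (rcons d (o, t)) = parse_step (parse d) (o, t) by rewrite /parse foldl_rcons.
rewrite /clauses in h5.
case: (parse d) h2 h3 h4 h5 => -[b cur] done /= h2 h3 h4 h5.
case: t h => [l|[]] h /=.
- split=> //=; rewrite ?den_op /=.
  + by rewrite (negbTE nK).
  + by move=> i; rewrite /= eqxx h3 Po map_rcons mem_rcons inE orbC eq_sym.
  + by move=> x; rewrite mem_rcons inE => /orP[/eqP ->|/h4].
  exact: JA.
- split=> //=; first by rewrite eqxx.
  exact: JB.
rewrite den_seq den_op /=; set s2 := den _ _ _.
suff [A2 B2 J2] : [/\ pset s2 vL = pset s1 vL, flag s2 fm = flag s1 fm &
    J [seq x.2 | x <- rcons done (b, cur) & x.1 == f] s2].
  clearbody s2; split=> //=; rewrite ?A2 ?B2 //.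
  - by rewrite (negbTE nK).
  - by move=> i; rewrite /= eqxx.
  exact: JA.
have -> : s2 = if f == b then den w c s1 else s1.
  by rewrite /s2; case: (f); rewrite den_if /= h2; case: (b).
rewrite filter_rcons /= [b == f]eq_sym; case: eqP => _ //.
split; [exact: frameA|exact: frameB|rewrite map_rcons; exact: JS].
Qed.

(** * Commands of the decision procedure *)

Local Notation vK1 := (vr 2).
Local Notation vK2 := (vr 3).
Local Notation vK3 := (vr 4).
Local Notation vsat := (vr 7).

Definition each_inner_clause (f : bool) (c : cmd) : cmd :=
  each_clause f (vr 2) vK3 (vr 6) (Seq (eval_clause vK3) (If (TestB vcs) Skip c)).

Definition round_cmd (f : bool) : cmd := each_inner_clause f (add_vars true vK3).
Definition check_cmd (f : bool) : cmd := each_inner_clause f (Op (SetB vsat false)).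

Definition optional (b : bool) (c : cmd) : cmd := if b then c else Skip.

Definition rounds_cmd (b1 b2 : bool) : cmd :=
  For (vr 8) (Seq (optional b1 (round_cmd false)) (optional b2 (round_cmd true))).

Definition falsify_cmd (K : var) : cmd :=
  Seq (eval_clause K) (If (TestB vcs) (Op (SetB vsat false)) Skip).

Definition result (b1 b2 : bool) : var :=
  if b1 then (if b2 then vr 8 else vr 9) else (if b2 then vr 10 else vr 11).

Definition witness_cmd (b1 b2 : bool) : cmd :=
  Seq (Op (Clear vT)) (Seq (add_vars false vK1) (Seq (add_vars false vK2)
  (Seq (rounds_cmd b1 b2) (Seq (Op (SetB vsat true))
  (Seq (falsify_cmd vK1) (Seq (falsify_cmd vK2)
  (Seq (optional b1 (check_cmd false)) (Seq (optional b2 (check_cmd true))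
  (If (TestB vsat) (Op (SetB (result b1 b2) true)) Skip))))))))).

Definition second_cmd (b1 b2 : bool) : cmd :=
  if b2 then witness_cmd b1 b2
  else each_clause true (vr 1) vK2 (vr 5) (witness_cmd b1 b2).

(** A formula to be satisfied gets no clause loop: its register, cleared here, then holds the empty
    clause of [falsified true]. *)
Definition joint_sat_cmd (b1 b2 : bool) : cmd :=
  Seq (Op (Clear vK1)) (Seq (Op (Clear vK2)) (Seq (Op (SetB (result b1 b2) false))
    (if b1 then second_cmd b1 b2
     else each_clause false (vr 0) vK1 (vr 4) (second_cmd b1 b2)))).

Definition lex_equiv_cmd : cmd :=
  Seq mark_literals
  (Seq (joint_sat_cmd true true) (Seq (joint_sat_cmd true false)
  (Seq (joint_sat_cmd false true) (Seq (joint_sat_cmd false false)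
  (Seq (Op (SetB (vr 12) true))
  (Seq (If (TestB (vr 8)) (If (TestB (vr 9)) (Op (SetB (vr 12) false)) Skip) Skip)
       (If (TestB (vr 10)) (If (TestB (vr 11)) (Op (SetB (vr 12) false)) Skip) Skip))))))).

(** * Correctness of the commands *)

Section Correctness.
Variables F1 F2 : formula.
Let ts := toks F1 ++ toks F2.
Let w := enc_toks ts.
Let F (f : bool) := if f then F2 else F1.

Definition ready (s : store) : Prop := pset s vL =1 lit_start w.

Lemma represents_eq s s' V : pset s' vT = pset s vT -> represents ts s V -> represents ts s' V.
Proof. by move=> e r o l h; rewrite e (r _ _ h). Qed.

Lemma round_cmdP f s V : ready s -> represents ts s V ->
  represents ts (den w (round_cmd f) s) (round (F f) V).
Proof.
move=> AL rV; rewrite /F -(clauses_pair f F1 F2).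
apply: (@each_clauseP ts f _ _ _ _ _
  (fun Ds s => represents ts s (round (map (map snd) Ds) V))) => //.
move=> Ds D s1 oD AL1 AK r1; rewrite map_rcons /round foldl_rcons -/(round _ _).
rewrite den_seq den_if /= (eval_clauseP _ AL1 AK oD r1) // /propagate.
set s2 := den _ (eval_clause _) _.
have A2 a : pset s2 a = pset s1 a by rewrite /s2 frameA.
have r2 := represents_eq (A2 vT) r1.
case: ifP => _; first exact: r2.
apply: add_varsP r2 => //; first by move=> i; rewrite A2 AL1.
by move=> i; rewrite A2 AK.
Qed.

Lemma rounds_cmdP b1 b2 s V : ready s -> represents ts s V ->
  represents ts (den w (rounds_cmd b1 b2) s)
    (iter (size w) (round (active b1 F1 ++ active b2 F2)) V).
Proof.
move=> AL rV.
pose J i s := ready s /\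
  represents ts s (iter i (round (active b1 F1 ++ active b2 F2)) V).
suff [] : J (size w) (den w (rounds_cmd b1 b2) s) by [].
apply: for_inv => // i s1 _ [AL1 r1].
rewrite /J iterS [round _ (iter _ _ _)]foldl_cat -/(round _ _) -/(round _ _).
have half b f s2 V2 : ready s2 -> represents ts s2 V2 ->
    ready (den w (optional b (round_cmd f)) s2) /\
    represents ts (den w (optional b (round_cmd f)) s2) (round (active b (F f)) V2).
  move=> AL2 r2; case: b => //=; split; last exact: round_cmdP.
  by rewrite /ready frameA //; case: f.
rewrite den_seq; have [AL2 r2] := half b1 false (updP s1 (vr 8) i) _ AL1 r1.
exact: half b2 true _ _ AL2 r2.
Qed.

Lemma check_cmdP f s V : ready s -> represents ts s V ->
  flag (den w (check_cmd f) s) vsat = flag s vsat && sat V (F f).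
Proof.
move=> AL rV; rewrite /F -(clauses_pair f F1 F2).
suff [] : represents ts (den w (check_cmd f) s) V /\
  flag (den w (check_cmd f) s) vsat =
  flag s vsat && sat V (map (map snd) (clauses f (positions 0 ts))) by [].
apply: (@each_clauseP ts f _ _ _ _ _
  (fun Ds s' => represents ts s' V /\ flag s' vsat = flag s vsat && sat V (map (map snd) Ds))) => //.
  by rewrite andbT.
move=> Ds D s1 oD AL1 AK [r1 e1].
rewrite map_rcons /sat all_rcons andbCA -e1.
rewrite den_seq den_if /= (eval_clauseP _ AL1 AK oD r1) //.
have e2 : flag (den w (eval_clause vK3) s1) vsat = flag s1 vsat by rewrite frameB.
have r2 : represents ts (den w (eval_clause vK3) s1) V.
  by apply: represents_eq r1; rewrite frameA.
by case: (sat_clause V _); rewrite /= ?e2.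
Qed.

Lemma falsify_cmdP (K : var) D s V : vT < K -> ready s -> clause_set s K D -> occurs ts D ->
  represents ts s V ->
  flag (den w (falsify_cmd K) s) vsat = flag s vsat && ~~ sat_clause V (map snd D).
Proof.
move=> ltK AL AK oD rV; rewrite den_seq den_if /= (eval_clauseP ltK AL AK oD rV).
have e2 : flag (den w (eval_clause K) s) vsat = flag s vsat by rewrite frameB.
by case: (sat_clause V _); rewrite /= ?e2 ?andbT ?andbF.
Qed.

Lemma witness_cmd_frame b1 b2 :
  [/\ ~~ modA (witness_cmd b1 b2) vL, ~~ modA (witness_cmd b1 b2) vK1,
      ~~ modA (witness_cmd b1 b2) vK2, ~~ modB (witness_cmd b1 b2) (vr 4) &
      ~~ modB (witness_cmd b1 b2) (vr 5)].
Proof. by case: b1; case: b2. Qed.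

Lemma witness_cmdP b1 b2 D1 D2 s : ready s ->
  clause_set s vK1 D1 -> clause_set s vK2 D2 -> occurs ts D1 -> occurs ts D2 ->
  flag (den w (witness_cmd b1 b2) s) (result b1 b2) =
  flag s (result b1 b2) ||
    witnesses (size w) (active b1 F1 ++ active b2 F2) (map snd D1) (map snd D2).
Proof.
move=> AL A1 A2 o1 o2; rewrite /witness_cmd.
rewrite den_seq; set s1 := den w (Op _) s.
have AL1 : ready s1 by [].
have r1 : represents ts s1 (fun=> false) by [].
have k1 : clause_set s1 vK1 D1 by [].
have l1 : clause_set s1 vK2 D2 by [].
have e1 : flag s1 (result b1 b2) = flag s (result b1 b2) by [].
(* From here on each intermediate store is made abstract, and the frame lemmas carry over the facts
   still needed about it. *)
clearbody s1; rewrite den_seq; set s2 := den w _ s1.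
have {}r1 := add_varsP false (isT : vT < vK1) AL1 k1 o1 r1.
rewrite -/w -/s2 in r1.
have {}AL1 : ready s2 by rewrite /ready /s2 frameA.
have {}k1 : clause_set s2 vK1 D1 by rewrite /clause_set /s2 frameA.
have {}l1 : clause_set s2 vK2 D2 by rewrite /clause_set /s2 frameA.
have {}e1 : flag s2 (result b1 b2) = flag s (result b1 b2).
  by rewrite /s2 frameB //; case: (b1); case: (b2).
clearbody s2; rewrite den_seq; set s3 := den w _ s2.
have {}r1 : represents ts s3 (neg_vars (map snd D1) (map snd D2)).
  exact: (add_varsP false (isT : vT < vK2) AL1 l1 o2 r1).
have {}AL1 : ready s3 by rewrite /ready /s3 frameA.
have {}k1 : clause_set s3 vK1 D1 by rewrite /clause_set /s3 frameA.
have {}l1 : clause_set s3 vK2 D2 by rewrite /clause_set /s3 frameA.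
have {}e1 : flag s3 (result b1 b2) = flag s (result b1 b2).
  by rewrite /s3 frameB //; case: (b1); case: (b2).
clearbody s3; rewrite den_seq; set s4 := den w _ s3.
have {}r1 : represents ts s4
    (candidate (size w) (active b1 F1 ++ active b2 F2) (map snd D1) (map snd D2)).
  exact: rounds_cmdP.
have {}AL1 : ready s4 by rewrite /ready /s4 frameA //; case: (b1); case: (b2).
have {}k1 : clause_set s4 vK1 D1.
  by rewrite /clause_set /s4 frameA //; case: (b1); case: (b2).
have {}l1 : clause_set s4 vK2 D2.
  by rewrite /clause_set /s4 frameA //; case: (b1); case: (b2).
have {}e1 : flag s4 (result b1 b2) = flag s (result b1 b2).
  by rewrite /s4 frameB //; case: (b1); case: (b2).
(* The candidate is now complete: the remaining commands leave [vT] unchanged and only lower [vsat]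
   when a requirement fails. *)
clearbody s4; rewrite /witnesses; move: (candidate _ _ _ _) r1 => V r1.
rewrite den_seq; set s5 := den w (Op _) s4.
have e5 : flag s5 vsat = true by [].
have f5 : flag s5 (result b1 b2) = flag s4 (result b1 b2) by rewrite /=; case: (b1); case: (b2).
have A5 a : pset s5 a = pset s4 a by [].
clearbody s5; rewrite den_seq.
have h6 : ready s5 by move=> i; rewrite A5 AL1.
have r6 := represents_eq (A5 vT) r1.
have k6 : clause_set s5 vK1 D1 by move=> i; rewrite A5 k1.
have := falsify_cmdP (isT : vT < vK1) h6 k6 o1 r6; set s6 := den w _ s5; rewrite e5 /= => e6.
have A6 a : pset s6 a = pset s5 a by rewrite /s6 frameA.
have f6 : flag s6 (result b1 b2) = flag s5 (result b1 b2).
  by rewrite /s6 frameB //; case: (b1); case: (b2).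
clearbody s6; rewrite den_seq.
have h7 : ready s6 by move=> i; rewrite A6 h6.
have r7 := represents_eq (A6 vT) r6.
have k7 : clause_set s6 vK2 D2 by move=> i; rewrite A6 A5 l1.
have := falsify_cmdP (isT : vT < vK2) h7 k7 o2 r7; set s7 := den w _ s6; rewrite e6 => e7.
have A7 a : pset s7 a = pset s6 a by rewrite /s7 frameA.
have f7 : flag s7 (result b1 b2) = flag s6 (result b1 b2).
  by rewrite /s7 frameB //; case: (b1); case: (b2).
clearbody s7; rewrite den_seq.
have h8 : ready s7 by move=> i; rewrite A7 h7.
have r8 := represents_eq (A7 vT) r7.
have check b f t : ready t -> represents ts t V ->
    [/\ ready (den w (optional b (check_cmd f)) t),
        represents ts (den w (optional b (check_cmd f)) t) V,
        flag (den w (optional b (check_cmd f)) t) vsat = flag t vsat && sat V (active b (F f)) &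
        flag (den w (optional b (check_cmd f)) t) (result b1 b2) = flag t (result b1 b2)].
  move=> At rt; case: b; last by split=> //=; rewrite andbT.
  split; [|apply: represents_eq rt|exact: check_cmdP|].
  - by rewrite /ready frameA //; case: f.
  - by rewrite frameA //; case: f.
  - by rewrite frameB //; case: f; case: (b1); case: (b2).
have [h9 r9 e9 f9] := check b1 false _ h8 r8.
rewrite den_seq; have [h10 r10 e10 f10] := check b2 true _ h9 r9.
rewrite den_if /= e10 e9 e7 -!andbA /sat all_cat -/(sat V _) -/(sat V _).
rewrite -e1 -f5 -f6 -f7 -f9 -f10; case: ifP => _; last by rewrite orbF.
by rewrite /= eqxx orbT.
Qed.

Lemma second_cmdP (b1 b2 : bool) D1 s : ready s -> clause_set s vK1 D1 -> occurs ts D1 ->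
  (b2 -> clause_set s vK2 [::]) ->
  flag (den w (second_cmd b1 b2) s) (result b1 b2) =
  flag s (result b1 b2) ||
    has (witnesses (size w) (active b1 F1 ++ active b2 F2) (map snd D1)) (falsified b2 F2).
Proof.
move=> AL A1 o1; case: b2 => [/(_ isT) A2|_].
  by rewrite (witness_cmdP b1 true AL A1 A2 o1) //= orbF.
have -> : falsified false F2 = map (map snd) (clauses true (positions 0 ts)).
  by rewrite clauses_pair.
set W := witnesses _ _ _.
suff [] : clause_set (den w (second_cmd b1 false) s) vK1 D1 /\
  flag (den w (second_cmd b1 false) s) (result b1 false) =
  flag s (result b1 false) || has W (map (map snd) (clauses true (positions 0 ts))) by [].
have [f1 f2 _ _ f5] := witness_cmd_frame b1 false.
apply: (@each_clauseP ts true _ _ _ _ _ (fun Ds s' => clause_set s' vK1 D1 /\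
  flag s' (result b1 false) = flag s (result b1 false) || has W (map (map snd) Ds))) => //.
- by move=> Ds s1 b [h1 h2]; split=> //; rewrite -h2; case: (b1).
- by rewrite orbF.
move=> Ds D s1 oD AL1 A2 [k1 e1]; split; first by rewrite /clause_set frameA.
by rewrite (witness_cmdP b1 false AL1 k1 A2 o1 oD) e1 map_rcons has_rcons -orbA [W _ || _]orbC.
Qed.

Lemma joint_sat_cmdP b1 b2 s : ready s ->
  flag (den w (joint_sat_cmd b1 b2) s) (result b1 b2) = joint_sat (size w) b1 b2 F1 F2.
Proof.
move=> AL; rewrite /joint_sat_cmd !den_seq !den_op.
set s1 := oden _ (oden _ _).
have AL1 : ready s1 by [].
have A1 : clause_set s1 vK1 [::] by [].
have A2 : clause_set s1 vK2 [::] by [].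
have e1 : flag s1 (result b1 b2) = false by rewrite /=; case: (b1); case: (b2).
clearbody s1; rewrite /joint_sat; case: b1 e1 => e1.
  by rewrite (second_cmdP true AL1 A1) // e1 /= orbF.
have -> : falsified false F1 = map (map snd) (clauses false (positions 0 ts)).
  by rewrite clauses_pair.
set W := fun C1 => has _ _.
(* The invariant also keeps [vK2] empty when [b2] holds, so that each inner run finds the empty
   clause there. *)
suff [] : (b2 -> clause_set
    (den w (each_clause false (vr 0) vK1 (vr 4) (second_cmd false b2)) s1) vK2 [::]) /\
  flag (den w (each_clause false (vr 0) vK1 (vr 4) (second_cmd false b2)) s1) (result false b2) =
  has W (map (map snd) (clauses false (positions 0 ts))) by [].
apply: (@each_clauseP ts false _ _ _ _ _ (fun Ds s' => (b2 -> clause_set s' vK2 [::]) /\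
  flag s' (result false b2) = has W (map (map snd) Ds))) => //.
- by case: (b2).
- by case: (b2).
- by move=> Ds s' b [h1 h2]; split=> //; rewrite -h2; case: (b2).
move=> Ds D s2 oD AL2 A3 [k2 e2]; split.
  by case: (b2) k2 => // /(_ isT) k2 _; rewrite /clause_set frameA.
by rewrite (second_cmdP false AL2 A3 oD k2) e2 map_rcons has_rcons orbC.
Qed.

Lemma lex_equiv_cmdP s :
  flag (den w lex_equiv_cmd s) (vr 12) =
  ~~ (joint_sat (size w) true true F1 F2 && joint_sat (size w) true false F1 F2) &&
  ~~ (joint_sat (size w) false true F1 F2 && joint_sat (size w) false false F1 F2).
Proof.
rewrite /lex_equiv_cmd.
rewrite den_seq; have := mark_literalsP w s; set s1 := den w _ s; clearbody s1 => AL1.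
rewrite den_seq; have := joint_sat_cmdP true true AL1.
set s2 := den w _ s1 => e2.
have AL2 : ready s2 by rewrite /ready /s2 frameA.
clearbody s2; rewrite den_seq; have := joint_sat_cmdP true false AL2.
set s3 := den w _ s2 => e3.
have AL3 : ready s3 by rewrite /ready /s3 frameA.
have {}e2 : flag s3 (vr 8) = joint_sat (size w) true true F1 F2 by rewrite /s3 frameB.
clearbody s3; rewrite den_seq; have := joint_sat_cmdP false true AL3.
set s4 := den w _ s3 => e4.
have AL4 : ready s4 by rewrite /ready /s4 frameA.
have {}e2 : flag s4 (vr 8) = joint_sat (size w) true true F1 F2 by rewrite /s4 frameB.
have {}e3 : flag s4 (vr 9) = joint_sat (size w) true false F1 F2 by rewrite /s4 frameB.
clearbody s4; rewrite den_seq; have := joint_sat_cmdP false false AL4.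
set s5 := den w _ s4 => e5.
have {}e2 : flag s5 (vr 8) = joint_sat (size w) true true F1 F2 by rewrite /s5 frameB.
have {}e3 : flag s5 (vr 9) = joint_sat (size w) true false F1 F2 by rewrite /s5 frameB.
have {}e4 : flag s5 (vr 10) = joint_sat (size w) false true F1 F2 by rewrite /s5 frameB.
clearbody s5; rewrite -e2 -e3 -e4 -e5 !denE /=.
by case E2: (flag s5 (vr 8)); case E3: (flag s5 (vr 9)); case E4: (flag s5 (vr 10));
  case E5: (flag s5 (vr 11)); rewrite /= ?E2 ?E3 ?E4 ?E5 /= ?E2 ?E3 ?E4 ?E5.
Qed.
End Correctness.

(** Each literal takes at least one symbol and the end mark makes the bound strict; so the input
    length is a sufficient number of rounds. *)
Lemma size_enc_formula F : size (flatten F) < size (enc_formula F).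
Proof.
rewrite /enc_formula size_cat addn1 ltnS; elim: F => //= C F IH.
rewrite size_cat [leqRHS]size_cat; apply: leq_add IH; rewrite /enc_clause size_cat.
apply: leq_trans (leq_addr _ _); elim: C => // l C IH.
by rewrite -[flatten _]/(enc_lit l ++ flatten (map enc_lit C)) size_cat -[size (l :: C)]add1n leq_add.
Qed.

Theorem theorem10 :
  exists M : TM,
    poly_time_decides_horn_pairs M
      (fun F1 F2 : formula => seq_equiv [:: F1; F2] [:: F1]).
Proof.
exists (decider lex_equiv_cmd (vr 12)); split; first exact: sweepTM_acc_rej.
have [a [k run_w]] := decider_correct (vr 12) (isT : for_ok lex_equiv_cmd).
(* The factor [2 ^ k] replaces [(size w).+1] by [2 * size w], which is larger as the input is not
   empty. *)
exists (a * 2 ^ k), k => F1 F2 h1 h2 w.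
have ew : w = enc_toks (toks F1 ++ toks F2).
  by rewrite /w /enc_pair !enc_formula_toks enc_toks_cat.
have lt : size (flatten F1) + size (flatten F2) < size w.
  rewrite /w /enc_pair size_cat.
  by have := size_enc_formula F1; have := size_enc_formula F2; lia.
have [t le_t e] := run_w w; exists t; split.
  apply: leq_trans le_t _; apply: leq_trans (leq_addr _ _).
  have le2 : (size w).+1 <= 2 * size w by lia.
  rewrite -mulnA -expnMn leq_mul2l; apply/orP; right.
  by case: k {run_w} => // k; rewrite leq_exp2r.
clearbody w; subst w; rewrite e lex_equiv_cmdP.
by case: (seq_equivP h1 h2 lt) => eqv; [left|right].
Qed.
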